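(* Let $N\ge1$ and $p\ge1$ be integers, and let $V:\mathbb{R}_+\to\mathbb{R}\cup\{\infty\}$ be a measurable function for which the beta ensemble with $\beta=2p$ and radial potential $V$ is well defined (i.e. its density has finite positive total mass). Let $(\lambda_1,\dots,\lambda_N)$ be distributed according to this ensemble, and let $M\ge(N-1)p+1$ be an integer. Then the $M$-th powers are conditionally independent given the latent variable $I$: conditioning on the event $\{I=\mathbf{u}\}$, $\mathbf{u}=(u_1,\dots,u_N)$, $$\{\lambda_1^M,\dots,\lambda_N^M\}\stackrel{d}{=}\{X_1^{M/2}e^{i\theta_1},\dots,X_N^{M/2}e^{i\theta_N}\},$$ where the variables $\theta_1,\dots,\theta_N,X_1,\dots,X_N$ are all independent, the angles $\theta_k$ are uniform on $[0,2\pi]$, and $X_k$ has the $\Gamma_V$ distribution with parameter $1+u_k$. That is, the law of the (unordered) set $\{\lambda_1^M,\dots,\lambda_N^M\}$ is the law of the set on the right-hand side obtained by first sampling $I$ and then, given $I=\mathbf{u}$, sampling the independent variables $\theta_k,X_k$ as described.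
   Context: The beta ensemble with parameter $\beta$ and radial potential $V$ is the law of $N$ complex random points with joint density $\frac{1}{\pi^NZ_{\beta,N}}\prod_{i<j}|z_i-z_j|^\beta\prod_{i=1}^Ne^{-V(|z_i|^2)}$ with respect to Lebesgue measure on $\mathbb{C}^N$, with $Z_{\beta,N}$ the normalizing constant. $\Gamma_V(\alpha)=\int_0^\infty t^{\alpha-1}e^{-V(t)}\,\mathrm{d}t$; when this is finite, the $\Gamma_V$ distribution of parameter $\alpha$ is the probability law on $\mathbb{R}_+$ with density $\frac{1}{\Gamma_V(\alpha)}t^{\alpha-1}e^{-V(t)}$. For $\mathbf{u}\in\mathbb{Z}^N$, $K_{N,p}(\mathbf{u})$ is the coefficient of $T_1^{u_1}\cdots T_N^{u_N}$ in the $p$-th power $\Delta(T_1,\dots,T_N)^p$ of the Vandermonde determinant in $N$ variables. The latent variable $I$ takes values in $\mathbb{Z}^N$ with distribution $$\mathbb{P}(I=\mathbf{u})=\frac{1}{Z_{2p,N}}K_{N,p}(\mathbf{u})^2\prod_{i=1}^N\Gamma_V(1+u_i)$$ (understood as $0$ when $K_{N,p}(\mathbf{u})=0$). *)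

(* Defs.v *)
From HB Require Import structures.
From mathcomp Require Import all_boot all_order all_algebra.
From mathcomp Require Import finmap multiset.
From mathcomp Require Import complex.
(* The notations of mpoly clash with those of MathComp-Analysis. *)
From mathcomp Require Import(canonicals) mpoly.
From mathcomp Require Import all_classical all_reals all_analysis.
From mathcomp Require Import measurable_realfun.

Set Implicit Arguments.
Unset Strict Implicit.
Unset Printing Implicit Defensive.

Import Order.TTheory GRing.Theory Num.Theory.
Import numFieldNormedType.Exports.

Local Open Scope classical_set_scope.
Local Open Scope ring_scope.

Definition complex_coord (R : realType) (z : R[i]) : R * R :=
  (complex.Re z, complex.Im z).

HB.instance Definition _ (R : realType) := isPointed.Build R[i] 0.

(* The Borel sigma-algebra of C = R^2 *)
HB.instance Definition _ (R : realType) :=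
  Measurable.copy R[i] (g_sigma_algebra_preimageType (@complex_coord R)).

Definition complex_lebesgue (R : realType) : set R[i] -> \bar R :=
  pushforward (lebesgue_measure \x lebesgue_measure)%E
    (fun xy : measurableTypeR R * measurableTypeR R =>
       Complex xy.1 xy.2 : R[i]).

Section tuple_measure.
Context d (T : measurableType d) (R : realType) (mu : set T -> \bar R).

(* This is a product measure only for sigma-finite mu. *)
Fixpoint tuple_measure (n : nat) {struct n} : set (n.-tuple T) -> \bar R :=
  match n with
  | 0 => \d_([tuple] : 0.-tuple T)
  | m.+1 => pushforward (mu \x @tuple_measure m)%E
      (fun xt : T * m.-tuple T => [tuple of xt.1 :: xt.2])
  end.

End tuple_measure.

Section beta_ensemble.
Context (R : realType) (N : nat) (beta : R) (V : R -> \bar R).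
Local Open Scope ereal_scope.

Definition beta_weight (z : N.-tuple R[i]) : \bar R :=
  (\prod_(i < N) \prod_(j < N | (i < j)%N)
     Normc.normc (tnth z i - tnth z j) `^ beta)%R%:E *
  \prod_(i < N) expeR (- V (Normc.normc (tnth z i) ^+ 2)%R).

Let leb := @tuple_measure _ _ _ (@complex_lebesgue R) N.

Definition beta_mass : \bar R := \int[leb]_(z in setT) beta_weight z.

Definition beta_well_defined : Prop := 0 < beta_mass < +oo.

Definition beta_Z : R := (fine beta_mass / pi ^+ N)%R.

Definition beta_ensemble (A : set (N.-tuple R[i])) : \bar R :=
  (pi ^+ N * beta_Z)^-1%:E * \int[leb]_(z in A) beta_weight z.

End beta_ensemble.

Section gammaV.
Context (R : realType) (V : R -> \bar R) (alpha : R).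
Local Open Scope ereal_scope.

Let weight (t : R) : \bar R := (t `^ (alpha - 1))%:E * expeR (- V t).

Definition gammaV : \bar R := \int[lebesgue_measure]_(t in `[0%R, +oo[) weight t.

(* A probability measure only when gammaV is finite and positive *)
Definition gammaV_law (A : set R) : \bar R :=
  (fine gammaV)^-1%:E *
  \int[lebesgue_measure]_(t in `[0%R, +oo[ `&` A) weight t.

End gammaV.

Lemma two_pi_gt0 (R : realType) : 0 < 2 * pi :> R.
Proof. by rewrite mulr_gt0 // pi_gt0. Qed.

Section vandermonde.
Variables (N p : nat) (u : {ffun 'I_N -> int}).

Definition vandermonde_poly : mpoly.mpoly N int :=
  \det (Vandermonde N (\row_(j < N) mpoly.mpolyX int (mpoly.mnm1 j) : 'rV[mpoly.mpoly N int]_N)).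

(* The coefficient of a monomial with a negative exponent is 0 *)
Definition vandermonde_coef : int :=
  if [forall i, 0 <= u i] then
    mpoly.mcoeff (mpoly.Multinom [tuple `|u i|%N | i < N])
      (vandermonde_poly ^+ p)
  else 0.

End vandermonde.

(* In \bar R, 0 * +oo = 0, so this is 0 as soon as the coefficient is. *)
Definition latent_pmf (R : realType) (N p : nat) (V : R -> \bar R)
    (u : {ffun 'I_N -> int}) : \bar R :=
  ((beta_Z N (2 * p)%:R V)^-1 * (vandermonde_coef p u)%:~R ^+ 2)%:E *
  (\prod_(i < N) gammaV V (1 + (u i)%:~R))%E.

Definition cond_prob d (T : measurableType d) (R : realType)
    (P : set T -> \bar R) (E A : set T) : \bar R :=
  (P (A `&` E) * (fine (P E))^-1%:E)%E.

(* Since A i may be setT, the product rule for the whole finite family gives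
   it for every subfamily *)
Definition mutually_independent d (T : measurableType d) (R : realType)
    (Q : set T -> \bar R) (J : finType) (Y : J -> T -> R) : Prop :=
  forall A : J -> set R, (forall j, measurable (A j)) ->
    Q (\bigcap_j Y j @^-1` A j) = (\prod_j Q (Y j @^-1` A j))%E.

Section latent_sample.
Context (R : realType) (N p : nat) (V : R -> \bar R).
Context d (T : measurableType d) (P : probability T R).
Variables (I : T -> {ffun 'I_N -> int}) (X theta : 'I_N -> {RV P >-> R}).

Definition latent_sample : Prop :=
  (forall u, measurable (I @^-1` [set u])) /\
  (forall u, P (I @^-1` [set u]) = latent_pmf p V u) /\
  (forall u, P (I @^-1` [set u]) != 0%E ->
    let Q := cond_prob P (I @^-1` [set u]) in
    [/\ mutually_independent Q
          (fun j : 'I_N + 'I_N =>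
             match j with inl k => theta k : T -> R | inr k => X k end),
        forall k (A : set R), measurable A ->
          Q (theta k @^-1` A) = uniform_prob (two_pi_gt0 R) A
      & forall k (A : set R), measurable A ->
          Q (X k @^-1` A) = gammaV_law V (1 + (u k)%:~R) A]).

Definition latent_points (M : nat) (w : T) : N.-tuple R[i] :=
  [tuple real_complex R (X k w `^ (M%:R / 2)) *
         Complex (cos (theta k w)) (sin (theta k w)) | k < N].

End latent_sample.

(* {z_1, ..., z_n} is taken with multiplicities. *)
Definition unordered (R : realType) n (z : n.-tuple R[i]) : {mset R[i]}%mset :=
  seq_mset z.

(* Unordered n-tuples carry the quotient sigma-algebra: B is measurable when
   its inverse image in C^n is. *)
Definition unordered_eq_law (R : realType) n
    d (T : measurableType d) (P : set T -> \bar R) (Y : T -> n.-tuple R[i])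
    d' (T' : measurableType d') (P' : set T' -> \bar R)
    (Y' : T' -> n.-tuple R[i]) : Prop :=
  forall B : set {mset R[i]}%mset,
    measurable (@unordered R n @^-1` B) ->
    P [set w | B (unordered (Y w))] = P' [set w | B (unordered (Y' w))].

(* Main.v *)
Require Import Defs.
From HB Require Import structures.
From mathcomp Require Import all_boot all_order all_algebra.
From mathcomp Require Import finmap multiset.
From mathcomp Require Import complex.
From mathcomp Require Import(canonicals) mpoly.
From mathcomp Require Import all_classical all_reals all_analysis.
From mathcomp Require Import measurable_realfun.
From mathcomp Require Import ring lra.

Set Implicit Arguments.
Unset Strict Implicit.
Unset Printing Implicit Defensive.

Import Order.TTheory GRing.Theory Num.Theory.
Import numFieldNormedType.Exports.

Local Open Scope classical_set_scope.
Local Open Scope ring_scope.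

(* The modulus squared of Delta(z)^p is the sum of K(u) K(v) z^u conj(z)^v over
   all exponents u and v, whose entries are at most (N - 1) p < M.  Multiplying
   each z_i by an M-th root of unity changes neither z_i^M nor |z_i|, and
   averaging over these rotations kills the terms with u <> v.  For functions of
   (z_1^M, ..., z_N^M) the beta ensemble is therefore a mixture, with weights
   proportional to K(u)^2, of the product densities
   \prod_i |z_i|^(2 u_i) e^(- V (|z_i|^2)).
   In one variable, rotation invariance and the fact that |z|^2 maps the Lebesgue
   measure of C to pi times that of R_+ show that under such a density z^M has
   a uniform angle, independent of |z|^2, which has the law Gamma_V of
   parameter 1 + u_i. *)

(** * Measures on tuples *)

(** Entries below [M] are equal as soon as they are congruent modulo [M], so the M-th roots of unity
    separate all exponents that occur; this is the role of the lower bound on [M]. Nothing is known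
    in advance about the finiteness of a single Gamma_V (1 + u_i). All integrands are therefore
    nonnegative and extended-valued, handled by Tonelli, and the finiteness of the factors of a term
    of positive weight is deduced afterwards from the finite total mass. Polar coordinates come
    without a Jacobian: the angle arises by averaging an invariant integral over rotations, the
    radius from uniqueness of Lebesgue measure on the line. Both halves of the theorem rest on one
    finite family of measures on N-tuples of pairs (x, theta), one for each exponent with entries
    below [M]. Their disjoint sum is an explicit latent sample, and the joint law of any latent
    sample on the event I = u is the member of index u, by uniqueness on rectangles. *)

Section product_sfm.
Context d1 d2 (T1 : measurableType d1) (T2 : measurableType d2) (R : realType).
Variables (m1 : {sigma_finite_measure set T1 -> \bar R})
  (m2 : {sigma_finite_measure set T2 -> \bar R}).
Local Open Scope ereal_scope.

(* [m1 \x m2] has a canonical sigma-finite structure in the library only for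
   subprobabilities. *)
Let prod := m1 \x m2.

HB.instance Definition _ := Measure.on prod.

Let prod_sigma_finite : sigma_finite setT prod.
Proof.
have /sigma_finiteP[F [FT ndF Foo]] := sigma_finiteT m1.
have /sigma_finiteP[G [GT ndG Goo]] := sigma_finiteT m2.
exists (fun n => F n `*` G n).
  apply/esym; rewrite -subTset => -[x y] _.
  have [i _ Fix] : (\bigcup_i F i) x by rewrite -FT.
  have [j _ Gjy] : (\bigcup_i G i) y by rewrite -GT.
  exists (maxn i j) => //; split => /=.
    exact: (subsetPset _ _ (ndF _ _ (leq_maxl i j))).
  exact: (subsetPset _ _ (ndG _ _ (leq_maxr i j))).
move=> k; have [mF Fk] := Foo k; have [mG Gk] := Goo k.
split; first exact: measurableX.
by rewrite /prod product_measure1E// lte_mul_pinfty// ge0_fin_numE.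
Qed.

HB.instance Definition _ :=
  Measure_isSigmaFinite.Build _ _ _ prod prod_sigma_finite.

Definition product_sfm : {sigma_finite_measure set (T1 * T2)%type -> \bar R} :=
  prod.

End product_sfm.

Section embed_measure.
Context d1 d2 (T1 : measurableType d1) (T2 : measurableType d2) (R : realType).
Variables (f : T1 -> T2) (g : T2 -> T1).
Hypotheses (mf : measurable_fun [set: T1] f) (mg : measurable_fun [set: T2] g).
Hypothesis fK : cancel f g.
Variable mu : {sigma_finite_measure set T1 -> \bar R}.
Local Open Scope ereal_scope.

Let map := pushforward mu f.

Let map0 : map set0 = 0. Proof. exact: measure0. Qed.

Let map_ge0 A : 0 <= map A. Proof. exact: measure_ge0. Qed.

Let map_sigma_additive : semi_sigma_additive map.
Proof. exact: measure_semi_sigma_additive. Qed.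

HB.instance Definition _ := isMeasure.Build _ _ _ map
  map0 map_ge0 map_sigma_additive.

(** A push-forward can fail to be sigma-finite; the measurable left inverse [g] pulls an exhaustion
    [F] back to sets whose image measure is that of [F k]. *)
Let map_sigma_finite : sigma_finite setT map.
Proof.
have [F FT Foo] := sigma_finiteT mu.
exists (fun k => g @^-1` F k); first by rewrite -preimage_bigcup -FT preimage_setT.
move=> k; have [mFk Fkoo] := Foo k; split.
  by rewrite -[X in measurable X]setTI; exact: mg.
rewrite /map /pushforward -comp_preimage (_ : _ \o _ = id) //.
by apply/funext => x /=; exact: fK.
Qed.

HB.instance Definition _ :=
  Measure_isSigmaFinite.Build _ _ _ map map_sigma_finite.

Definition embed_measure : {sigma_finite_measure set T2 -> \bar R} := map.

End embed_measure.

Lemma emeasurable_prod d (T : measurableType d) (R : realType) (I : Type)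
    (s : seq I) (h : I -> T -> \bar R) :
  (forall i, measurable_fun setT (h i)) ->
  measurable_fun setT (fun x => \prod_(i <- s) h i x)%E.
Proof.
move=> mh; elim: s => [|i s IH].
  by under eq_fun do rewrite big_nil; exact: measurable_cst.
by under eq_fun do rewrite big_cons; exact: emeasurable_funM.
Qed.

Section tuple_measure_theory.
Context d (T : measurableType d) (R : realType).
Variable mu : {sigma_finite_measure set T -> \bar R}.
Local Open Scope ereal_scope.

Let cons_pair n (xt : T * n.-tuple T) : n.+1.-tuple T := [tuple of xt.1 :: xt.2].

Let measurable_cons_pair n : measurable_fun setT (@cons_pair n).
Proof. exact: measurable_cons. Qed.

Let uncons n (t : n.+1.-tuple T) : T * n.-tuple T :=
  (thead t, [tuple of behead t]).

Let measurable_uncons n : measurable_fun setT (@uncons n).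
Proof.
apply: measurable_fun_pair; last exact: measurable_behead.
exact: (@measurable_tnth _ T n.+1 ord0).
Qed.

Let cons_pairK n : cancel (@cons_pair n) (@uncons n).
Proof.
move=> [x t]; rewrite /uncons /cons_pair /=; congr pair.
by apply/val_inj.
Qed.

(** [tuple_measure] is a bare set function; the existential carries a sigma-finite structure through
    the induction, as Tonelli requires. *)
Lemma tuple_measure_ex n :
  exists nu : {sigma_finite_measure set (n.-tuple T) -> \bar R},
    @tuple_measure _ _ _ mu n = nu :> (set _ -> _).
Proof.
elim: n => [|n [nu nuE]].
  by exists (\d_([tuple] : 0.-tuple T)).
by exists (embed_measure (@measurable_cons_pair n) (@measurable_uncons n)
  (@cons_pairK n) (product_sfm mu nu)); rewrite /= nuE.
Qed.

Definition tuple_sfm n : {sigma_finite_measure set (n.-tuple T) -> \bar R} :=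
  sval (cid (tuple_measure_ex n)).

Lemma tuple_sfmE n : @tuple_measure _ _ _ mu n = tuple_sfm n.
Proof. by rewrite /tuple_sfm; case: cid. Qed.

Lemma tuple_integral_cons n (F : n.+1.-tuple T -> \bar R) :
  measurable_fun setT F -> (forall t, 0 <= F t) ->
  \int[@tuple_measure _ _ _ mu n.+1]_t F t =
  \int[mu]_x \int[@tuple_measure _ _ _ mu n]_t F [tuple of x :: t].
Proof.
move=> mF F0; rewrite /= tuple_sfmE ge0_integral_pushforward//; last first.
  exact: (@measurable_cons_pair n).
rewrite preimage_setT.
rewrite fubini_tonelli1// => [|x]; last exact: F0.
exact: measurableT_comp mF (@measurable_cons_pair n).
Qed.

Lemma tuple_integral_nil (F : 0.-tuple T -> \bar R) :
  measurable_fun setT F -> (forall t, 0 <= F t) ->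
  \int[@tuple_measure _ _ _ mu 0]_t F t = F [tuple].
Proof. by move=> mF F0; rewrite /= integral_dirac// diracT mul1e. Qed.

Lemma measurable_prod_tnth n (f : 'I_n -> T -> \bar R) :
  (forall i, measurable_fun setT (f i)) ->
  measurable_fun setT (fun t : n.-tuple T => \prod_(i < n) f i (tnth t i)).
Proof.
move=> mf; apply: emeasurable_prod => i.
by apply: (measurableT_comp (mf i)); exact: measurable_tnth.
Qed.

Lemma tuple_integral_prod n (f : 'I_n -> T -> \bar R) :
  (forall i, measurable_fun setT (f i)) -> (forall i x, 0 <= f i x) ->
  \int[@tuple_measure _ _ _ mu n]_t \prod_(i < n) f i (tnth t i) =
  \prod_(i < n) \int[mu]_x f i x.
Proof.
elim: n f => [|n IH] f mf f0.
  rewrite tuple_integral_nil ?big_ord0// => [|t].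
    exact: measurable_prod_tnth.
  exact: prode_ge0.
rewrite tuple_integral_cons; last 2 first.
- exact: measurable_prod_tnth.
- by move=> t; exact: prode_ge0.
rewrite big_ord_recl -ge0_integralZr//; last first.
  by apply: prode_ge0 => i _; exact: integral_ge0.
apply: eq_integral => x _.
rewrite -IH// tuple_sfmE -ge0_integralZl//; last 2 first.
- exact: (measurable_prod_tnth (fun i => mf (lift ord0 i))).
- by move=> t _; exact: prode_ge0.
apply: eq_integral => t _; rewrite big_ord_recl; congr (_ * _).
by apply: eq_bigr => i _; rewrite tnthS.
Qed.

End tuple_measure_theory.

Lemma mktuple_consE (T S : Type) n (f : 'I_n.+1 -> T -> S) (x : T) (t : n.-tuple T) :
  [tuple f i (tnth [tuple of x :: t] i) | i < n.+1] =
  [tuple of f ord0 x :: [tuple f (lift ord0 i) (tnth t i) | i < n]].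
Proof.
apply: eq_from_tnth => i; rewrite tnth_mktuple.
case: (unliftP ord0 i) => [j|] ->; last by rewrite !tnth0.
by rewrite !tnthS tnth_mktuple.
Qed.

Lemma measurable_mktuple d1 (T : measurableType d1) d2 (S : measurableType d2) n
    (f : 'I_n -> T -> S) :
  (forall i, measurable_fun setT (f i)) ->
  measurable_fun setT (fun t : n.-tuple T => [tuple f i (tnth t i) | i < n]).
Proof.
move=> mf; apply/measurable_fun_tnthP => i.
rewrite (_ : _ \o _ = f i \o (fun t => tnth t i)); last first.
  by apply/funext => t /=; rewrite tnth_mktuple.
by apply: (measurableT_comp (mf i)); exact: measurable_tnth.
Qed.

Section tuple_transport.
Context d1 (T1 : measurableType d1) d2 (T2 : measurableType d2)
  d (S : measurableType d) (R : realType).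
Variables (mu1 : {sigma_finite_measure set T1 -> \bar R})
  (mu2 : {sigma_finite_measure set T2 -> \bar R}).
Local Open Scope ereal_scope.

(* The coordinates are replaced one at a time, by Tonelli. *)
Lemma tuple_integral_transport n
    (phi : 'I_n -> T1 -> S) (psi : 'I_n -> T2 -> S)
    (a : 'I_n -> T1 -> \bar R) (b : 'I_n -> T2 -> \bar R)
    (mphi : forall i, measurable_fun setT (phi i))
    (mpsi : forall i, measurable_fun setT (psi i))
    (ma : forall i, measurable_fun setT (a i))
    (mb : forall i, measurable_fun setT (b i))
    (a0 : forall i x, 0 <= a i x) (b0 : forall i x, 0 <= b i x)
    (ab : forall i (g : S -> \bar R), measurable_fun setT g ->
      (forall s, 0 <= g s) ->
      \int[mu1]_x (g (phi i x) * a i x) = \int[mu2]_x (g (psi i x) * b i x))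
    (G : n.-tuple S -> \bar R) :
  measurable_fun setT G -> (forall s, 0 <= G s) ->
  \int[@tuple_measure _ _ _ mu1 n]_t
    (G [tuple phi i (tnth t i) | i < n] * \prod_(i < n) a i (tnth t i)) =
  \int[@tuple_measure _ _ _ mu2 n]_t
    (G [tuple psi i (tnth t i) | i < n] * \prod_(i < n) b i (tnth t i)).
Proof.
elim: n phi psi a b mphi mpsi ma mb a0 b0 ab G
  => [|n IH] phi psi a b mphi mpsi ma mb a0 b0 ab G mG G0.
  rewrite !tuple_integral_nil.
  - by rewrite !big_ord0; congr (G _ * _); apply: eq_from_tnth => -[].
  - apply: emeasurable_funM; last exact: measurable_prod_tnth.
    by apply: measurableT_comp => //; exact: measurable_mktuple.
  - by move=> t; rewrite mule_ge0// prode_ge0.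
  - apply: emeasurable_funM; last exact: measurable_prod_tnth.
    by apply: measurableT_comp => //; exact: measurable_mktuple.
  - by move=> t; rewrite mule_ge0// prode_ge0.
have mcons1 s : measurable_fun setT (fun t : n.-tuple S => [tuple of s :: t]).
  by apply: measurable_cons => //; exact: measurable_cst.
rewrite !tuple_integral_cons; last first.
- by move=> t; rewrite mule_ge0// prode_ge0.
- apply: emeasurable_funM; last exact: measurable_prod_tnth.
  by apply: measurableT_comp => //; exact: measurable_mktuple.
- by move=> t; rewrite mule_ge0// prode_ge0.
- apply: emeasurable_funM; last exact: measurable_prod_tnth.
  by apply: measurableT_comp => //; exact: measurable_mktuple.
(* The first point is frozen at [s], and the others are already integrated on the side of [mu2]. *)
pose H s := \int[@tuple_measure _ _ _ mu2 n]_t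
   (G [tuple of s :: [tuple psi (lift ord0 i) (tnth t i) | i < n]] *
    \prod_(i < n) b (lift ord0 i) (tnth t i)).
have H0 s : 0 <= H s.
  by rewrite /H tuple_sfmE; apply: integral_ge0 => t _; rewrite mule_ge0// prode_ge0.
have mH : measurable_fun setT H.
  rewrite /H tuple_sfmE.
  apply: (@measurable_fun_fubini_tonelli_F _ _ _ _ _ (tuple_sfm mu2 n)
    (fun st => G [tuple of st.1 ::
         [tuple psi (lift ord0 i) (tnth st.2 i) | i < n]] *
    \prod_(i < n) b (lift ord0 i) (tnth st.2 i))) => [|st]; last first.
    by rewrite mule_ge0// prode_ge0.
  apply: emeasurable_funM.
    apply: measurableT_comp => //; apply: measurable_cons => //.
    exact: (measurableT_comp (measurable_mktuple
      (fun i => mpsi (lift ord0 i))) measurable_snd).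
  exact: (measurableT_comp (measurable_prod_tnth
      (fun i => mb (lift ord0 i))) measurable_snd).
(* The induction hypothesis moves the last [n] coordinates at fixed [x]; then [ab], with test
   function [H], moves the first one. *)
transitivity (\int[mu1]_x (H (phi ord0 x) * a ord0 x)).
  apply: eq_integral => x _; rewrite muleC.
  have <- : _ = H (phi ord0 x) := IH
    (fun i => phi (lift ord0 i)) (fun i => psi (lift ord0 i))
    (fun i => a (lift ord0 i)) (fun i => b (lift ord0 i))
    (fun i => mphi _) (fun i => mpsi _) (fun i => ma _) (fun i => mb _)
    (fun i => a0 _) (fun i => b0 _) (fun i => ab _)
    (fun t => G [tuple of phi ord0 x :: t])
    (measurableT_comp mG (mcons1 _)) (fun t => G0 _).
  rewrite tuple_sfmE -ge0_integralZl//; last 2 first.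
  - apply: emeasurable_funM.
      apply: (measurableT_comp mG); apply: (measurableT_comp (mcons1 _)).
      exact: (measurable_mktuple (fun i => mphi (lift ord0 i))).
    exact: (measurable_prod_tnth (fun i => ma (lift ord0 i))).
  - by move=> t _; rewrite mule_ge0// prode_ge0.
  apply: eq_integral => t _; rewrite mktuple_consE big_ord_recl muleCA.
  by congr (_ * (_ * _)); apply: eq_bigr => i _; rewrite tnthS.
rewrite ab//; apply: eq_integral => x _; rewrite muleC /H.
rewrite tuple_sfmE -ge0_integralZl//; last 2 first.
- apply: emeasurable_funM.
    apply: (measurableT_comp mG); apply: (measurableT_comp (mcons1 _)).
    exact: (measurable_mktuple (fun i => mpsi (lift ord0 i))).
  exact: (measurable_prod_tnth (fun i => mb (lift ord0 i))).
- by move=> t _; rewrite mule_ge0// prode_ge0.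
apply: eq_integral => t _; rewrite mktuple_consE big_ord_recl muleCA.
by congr (_ * (_ * _)); apply: eq_bigr => i _; rewrite tnthS.
Qed.

End tuple_transport.

(** * Lebesgue measure on the complex plane *)

Section lebesgue_affine.
Context (R : realType).
Local Notation mu := (@lebesgue_measure R).
Local Open Scope ereal_scope.

(** Uniqueness of Lebesgue measure: [c] times its image under the affine map gives each interval ]a,
    b] its length. *)
Lemma lebesgue_measure_affine (c e : R) (c0 : (0 < c)%R) (A : set R) :
  measurable A -> mu [set x | A (c * x + e)%R] = (c^-1)%:E * mu A.
Proof.
move=> mA.
pose phi : R -> measurableTypeR R := fun x => (c * x + e)%R.
have mphi : measurable_fun setT phi.
  by apply: measurable_funD => //; exact: measurable_funM.
pose cn := NngNum (ltW c0).
suff H : mu A = mscale cn (pushforward mu phi) A.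
  rewrite (H mphi) /mscale /= muleA -EFinM mulVf ?mul1e//; exact: lt0r_neq0.
move=> m; apply: lebesgue_measure_unique => //= _ [[a b]] _ <-.
rewrite /mscale/= /pushforward.
rewrite (_ : phi @^-1` _ = `](a - e) / c, (b - e) / c]%classic)%R; last first.
  apply/seteqP; split => x /=; rewrite !in_itv/= /phi ltr_pdivrMr// ler_pdivlMr//;
    by rewrite ltrBlDr lerBrDr [(x * c)%R]mulrC.
rewrite !lebesgue_measure_itv/= !lte_fin ltr_pM2r ?invr_gt0// ltrD2r.
case: ifPn => ab; last by rewrite mule0.
by rewrite -!EFinB -EFinM; congr EFin; rewrite /=; field; exact: lt0r_neq0.
Qed.

Lemma ge0_integral_affine (c e : R) (c0 : (0 < c)%R) (f : R -> \bar R) :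
  measurable_fun setT f -> (forall x, 0 <= f x) ->
  \int[mu]_x f (c * x + e)%R = (c^-1)%:E * \int[mu]_x f x.
Proof.
move=> mf f0.
pose phi : R -> measurableTypeR R := fun x => (c * x + e)%R.
have mphi : measurable_fun setT phi.
  by apply: measurable_funD => //; exact: measurable_funM.
have ci0 : (0 <= c^-1)%R by rewrite invr_ge0 ltW.
pose cn := NngNum ci0.
rewrite -[RHS](ge0_integral_mscale mu measurableT cn)//.
transitivity (\int[pushforward mu phi]_x f x).
  by rewrite ge0_integral_pushforward.
apply: eq_measure_integral => //= A mA _.
rewrite /mscale /pushforward /=; exact: lebesgue_measure_affine.
Qed.

Lemma ge0_integral_translation (e : R) (f : R -> \bar R) :
  measurable_fun setT f -> (forall x, 0 <= f x) ->
  \int[mu]_x f (x + e)%R = \int[mu]_x f x.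
Proof.
move=> mf f0; rewrite -[RHS]mul1e -[1%R]invr1 -(ge0_integral_affine e)//.
by apply: eq_integral => x _; rewrite mul1r.
Qed.

End lebesgue_affine.

(** * Measurability of complex arithmetic and the squared modulus *)

Section complex_measurable.
Context (R : realType).

Lemma complexME (a b c e : R) :
  Complex a b * Complex c e = Complex (a * c - b * e) (a * e + b * c).
Proof. by []. Qed.

Lemma measurable_complex_coord : measurable_fun setT (@complex_coord R).
Proof. by move=> _ B mB; exists B. Qed.

Lemma measurable_Re : measurable_fun setT (@complex.Re R).
Proof. exact: (measurableT_comp measurable_fst measurable_complex_coord). Qed.

Lemma measurable_Im : measurable_fun setT (@complex.Im R).
Proof. exact: (measurableT_comp measurable_snd measurable_complex_coord). Qed.

Lemma measurable_complexP d (T : measurableType d) (f : T -> R[i]) :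
  measurable_fun setT (fun x => complex.Re (f x)) ->
  measurable_fun setT (fun x => complex.Im (f x)) -> measurable_fun setT f.
Proof.
move=> mr mi _ _ [B mB <-]; rewrite !setTI.
have /(_ measurableT _ mB) := measurable_fun_pair mr mi.
by rewrite setTI.
Qed.

Lemma measurable_Complex d (T : measurableType d) (f g : T -> R) :
  measurable_fun setT f -> measurable_fun setT g ->
  measurable_fun setT (fun x => Complex (f x) (g x)).
Proof. by move=> mf mg; apply: measurable_complexP. Qed.

Lemma measurable_complexM d (T : measurableType d) (f g : T -> R[i]) :
  measurable_fun setT f -> measurable_fun setT g ->
  measurable_fun setT (fun x => f x * g x).
Proof.
move=> mf mg.
have mfr := measurableT_comp measurable_Re mf.
have mfi := measurableT_comp measurable_Im mf.
have mgr := measurableT_comp measurable_Re mg.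
have mgi := measurableT_comp measurable_Im mg.
rewrite (_ : (fun _ => _) = fun x =>
  Complex (complex.Re (f x) * complex.Re (g x) - complex.Im (f x) * complex.Im (g x))
    (complex.Re (f x) * complex.Im (g x) + complex.Im (f x) * complex.Re (g x))).
  apply: measurable_Complex.
    by apply: measurable_funB; apply: measurable_funM.
  by apply: measurable_funD; apply: measurable_funM.
by apply/funext => x; case: (f x) (g x) => [a b] [c e].
Qed.

Lemma measurable_complexX d (T : measurableType d) (f : T -> R[i]) n :
  measurable_fun setT f -> measurable_fun setT (fun x => f x ^+ n).
Proof.
move=> mf; elim: n => [|n IH]; first exact: measurable_cst.
under eq_fun do rewrite exprS; exact: measurable_complexM.
Qed.

Lemma measurable_complex_prod d (T : measurableType d) (J : Type) (s : seq J)
    (Q : pred J) (h : J -> T -> R[i]) :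
  (forall j, measurable_fun setT (h j)) ->
  measurable_fun setT (fun x => \prod_(j <- s | Q j) h j x).
Proof.
move=> mh; elim: s => [|j s IH].
  by under eq_fun do rewrite big_nil; exact: measurable_cst.
under eq_fun do rewrite big_cons; case: (Q j) => //.
exact: measurable_complexM.
Qed.

Lemma measurable_complexB d (T : measurableType d) (f g : T -> R[i]) :
  measurable_fun setT f -> measurable_fun setT g ->
  measurable_fun setT (fun x => f x - g x).
Proof.
move=> mf mg.
have mfr := measurableT_comp measurable_Re mf.
have mfi := measurableT_comp measurable_Im mf.
have mgr := measurableT_comp measurable_Re mg.
have mgi := measurableT_comp measurable_Im mg.
rewrite (_ : (fun _ => _) = fun x =>
  Complex (complex.Re (f x) - complex.Re (g x))
    (complex.Im (f x) - complex.Im (g x))).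
  by apply: measurable_Complex; apply: measurable_funB.
by apply/funext => x; case: (f x) (g x) => [a b] [c e].
Qed.

Definition sqnorm (z : R[i]) : R := complex.Re z ^+ 2 + complex.Im z ^+ 2.

Lemma sqnorm_ge0 z : 0 <= sqnorm z.
Proof. by rewrite addr_ge0// sqr_ge0. Qed.

Lemma normc_sqnorm z : Normc.normc z ^+ 2 = sqnorm z.
Proof. by case: z => a b; rewrite /sqnorm /= sqr_sqrtr// addr_ge0// sqr_ge0. Qed.

Lemma sqnormM z w : sqnorm (z * w) = sqnorm z * sqnorm w.
Proof. by case: z w => a b [c e]; rewrite /sqnorm /=; ring. Qed.

Lemma sqnorm1 : sqnorm (1 : R[i]) = 1.
Proof. by rewrite /sqnorm /= expr0n addr0 expr1n. Qed.

Lemma sqnormX (z : R[i]) n : sqnorm (z ^+ n) = sqnorm z ^+ n.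
Proof.
by elim: n => [|n IH]; rewrite ?expr0 ?sqnorm1// !exprS sqnormM IH.
Qed.

Lemma measurable_sqnorm : measurable_fun setT sqnorm.
Proof.
by apply: measurable_funD; apply: measurable_funX;
  [exact: measurable_Re|exact: measurable_Im].
Qed.

End complex_measurable.

(** * Linear changes of variable in the plane *)

Section complex_lebesgue.
Context (R : realType).
Local Notation mu := (@lebesgue_measure R).
Local Open Scope ereal_scope.

Let mk (xy : measurableTypeR R * measurableTypeR R) : R[i] := Complex xy.1 xy.2.

Let measurable_mk : measurable_fun setT mk.
Proof. by apply: measurable_Complex. Qed.

Let mkK : cancel mk (@complex_coord R). Proof. by case. Qed.

Definition complex_sfm : {sigma_finite_measure set R[i] -> \bar R} :=
  embed_measure measurable_mk (@measurable_complex_coord R) mkK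
    (product_sfm mu mu).

Lemma complex_integralE (f : R[i] -> \bar R) :
  measurable_fun setT f -> (forall z, 0 <= f z) ->
  \int[complex_sfm]_z f z = \int[mu]_x \int[mu]_y f (Complex x y).
Proof.
move=> mf f0; rewrite ge0_integral_pushforward//=.
rewrite preimage_setT fubini_tonelli1//.
exact: (measurableT_comp mf measurable_mk).
Qed.

Lemma complex_integralE_swap (f : R[i] -> \bar R) :
  measurable_fun setT f -> (forall z, 0 <= f z) ->
  \int[complex_sfm]_z f z = \int[mu]_y \int[mu]_x f (Complex x y).
Proof.
move=> mf f0; rewrite ge0_integral_pushforward//=.
rewrite preimage_setT fubini_tonelli2//.
exact: (measurableT_comp mf measurable_mk).
Qed.

Lemma complex_integral_scale (c : R) (f : R[i] -> \bar R) : (0 < c)%R ->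
  measurable_fun setT f -> (forall z, 0 <= f z) ->
  \int[complex_sfm]_z f (c%:C%C * z)%R = (c ^- 2)%:E * \int[complex_sfm]_z f z.
Proof.
move=> c0 mf f0.
have mfc : measurable_fun setT (fun z => f (c%:C%C * z)%R).
  apply: (measurableT_comp mf); apply: measurable_complexM => //.
rewrite !complex_integralE//.
have mxy (x : R) : measurable_fun setT (fun y : R => f (Complex x y)).
  by apply: (measurableT_comp mf); apply: measurable_Complex.
have mF : measurable_fun setT (fun x : R => \int[mu]_y f (Complex x y)).
  apply: (@measurable_fun_fubini_tonelli_F _ _ _ _ _ mu (f \o mk)) => [|z].
    exact: (measurableT_comp mf measurable_mk).
  exact: f0.
have F0 (x : R) : 0 <= \int[mu]_y f (Complex x y) by exact: integral_ge0.
transitivity ((c^-1)%:E * \int[mu]_x \int[mu]_y f (Complex (c * x + 0)%R y)).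
  rewrite -ge0_integralZl//; last 2 first.
  - by apply: (measurableT_comp mF); apply: measurable_funD.
  - by rewrite lee_fin invr_ge0 ltW.
  apply: eq_integral => x _; rewrite -(ge0_integral_affine 0 c0)//.
  apply: eq_integral => y _; congr f.
  by rewrite [LHS](complexME c 0 x y); congr Complex; ring.
have /= -> := ge0_integral_affine 0 c0 mF F0.
by rewrite muleA -EFinM -invfM -expr2.
Qed.

(** At fixed imaginary part the shear is a translation, so the real part is integrated first. *)
Lemma complex_integral_shear (t : R) (f : R[i] -> \bar R) :
  measurable_fun setT f -> (forall z, 0 <= f z) ->
  \int[complex_sfm]_z f (Complex (complex.Re z + t * complex.Im z)
    (complex.Im z))%R = \int[complex_sfm]_z f z.
Proof.
move=> mf f0; have mS : measurable_fun setT (fun z : R[i] =>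
    Complex (complex.Re z + t * complex.Im z) (complex.Im z))%R.
  apply: measurable_Complex; last exact: measurable_Im.
  apply: measurable_funD; first exact: measurable_Re.
  by apply: measurable_funM => //; exact: measurable_Im.
rewrite (complex_integralE_swap (measurableT_comp mf mS) (fun=> f0 _)).
rewrite (complex_integralE_swap mf f0); apply: eq_integral => y _.
rewrite -[RHS](ge0_integral_translation (t * y)%R)//.
by apply: (measurableT_comp mf); apply: measurable_Complex.
Qed.

Lemma complex_integral_shear' (t : R) (f : R[i] -> \bar R) :
  measurable_fun setT f -> (forall z, 0 <= f z) ->
  \int[complex_sfm]_z f (Complex (complex.Re z)
    (complex.Im z + t * complex.Re z))%R = \int[complex_sfm]_z f z.
Proof.
move=> mf f0; have mS : measurable_fun setT (fun z : R[i] =>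
    Complex (complex.Re z) (complex.Im z + t * complex.Re z))%R.
  apply: measurable_Complex; first exact: measurable_Re.
  apply: measurable_funD; first exact: measurable_Im.
  by apply: measurable_funM => //; exact: measurable_Re.
rewrite (complex_integralE (measurableT_comp mf mS) (fun=> f0 _)).
rewrite (complex_integralE mf f0); apply: eq_integral => x _.
rewrite -[RHS](ge0_integral_translation (t * x)%R)//.
by apply: (measurableT_comp mf); apply: measurable_Complex.
Qed.

(* A rotation of angle different from pi is a product of three shears, with
   tan (theta / 2) = sin theta / (1 + cos theta). *)
Lemma complex_integral_rotation (w : R[i]) (f : R[i] -> \bar R) :
  sqnorm w = 1%R -> measurable_fun setT f -> (forall z, 0 <= f z) ->
  \int[complex_sfm]_z f (w * z)%R = \int[complex_sfm]_z f z.
Proof.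
have rot (v : R[i]) (g : R[i] -> \bar R) : sqnorm v = 1%R ->
    complex.Re v != (-1)%R -> measurable_fun setT g -> (forall z, 0 <= g z) ->
    \int[complex_sfm]_z g (v * z)%R = \int[complex_sfm]_z g z.
  move=> cs c1 mg g0; pose c := complex.Re v; pose s := complex.Im v.
  have vE : v = Complex c s by rewrite /c /s; case: (v).
  rewrite /sqnorm -/c -/s in cs.
  have c10 : (1 + c != 0)%R by rewrite addrC addr_eq0 -/c.
  pose t := (- s / (1 + c))%R.
  pose S (z : R[i]) := (Complex (complex.Re z + t * complex.Im z) (complex.Im z))%R.
  pose S' (z : R[i]) := (Complex (complex.Re z) (complex.Im z + s * complex.Re z))%R.
  have mS : measurable_fun setT S.
    apply: measurable_Complex; last exact: measurable_Im.
    apply: measurable_funD; first exact: measurable_Re.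
    by apply: measurable_funM => //; exact: measurable_Im.
  have mS' : measurable_fun setT S'.
    apply: measurable_Complex; first exact: measurable_Re.
    apply: measurable_funD; first exact: measurable_Im.
    by apply: measurable_funM => //; exact: measurable_Re.
  rewrite -[RHS](complex_integral_shear t mg g0).
  rewrite -[RHS](complex_integral_shear' s (measurableT_comp mg mS) (fun=> g0 _)).
  rewrite -[RHS](complex_integral_shear t
    (measurableT_comp (measurableT_comp mg mS) mS') (fun=> g0 _)).
  apply: eq_integral => z _; rewrite vE; case: z => x y.
  congr g; rewrite /S /S'/=.
  have cs' : (s ^+ 2 = (1 - c) * (1 + c))%R.
    by rewrite -[LHS](addKr (c ^+ 2)%R) cs; ring.
  have st : (s * t = c - 1)%R.
    rewrite /t mulrA mulrN -expr2 cs' mulNr mulfK//; ring.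
  have tc : (t * (1 + c) = - s)%R by rewrite /t mulfVK.
  rewrite complexME; congr Complex.
    transitivity ((1 + s * t) * x + t * (1 + (1 + s * t)) * y)%R; last by ring.
    rewrite st (_ : 1 + (c - 1) = c)%R; last by ring.
    by rewrite tc mulNr.
  transitivity ((1 + s * t) * y + s * x)%R; last by ring.
  by rewrite st; ring.
case: (eqVneq (complex.Re w) (-1)%R) => [w1|w1 nw mf f0]; last exact: rot.
(* The rotation by pi, which the shears miss, is the rotation by i applied twice. *)
move=> nw mf f0; have wi : complex.Im w = 0%R.
  move: nw; rewrite /sqnorm w1 sqrrN expr1n => i1.
  by apply/eqP; rewrite -sqrf_eq0 -(inj_eq (addrI 1%R)) addr0; apply/eqP.
have -> : w = Complex (-1)%R 0%R by rewrite -w1 -wi; case: (w).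
have ni : sqnorm ('i%C : R[i]) = 1%R by rewrite /sqnorm /= expr0n add0r expr1n.
have i1 : complex.Re ('i%C : R[i]) != (-1)%R.
  by rewrite /= eq_sym oppr_eq0 oner_eq0.
have mif : measurable_fun setT (fun z : R[i] => f ('i%C * z)%R).
  by apply: (measurableT_comp mf); apply: measurable_complexM.
rewrite -[RHS](rot _ _ ni i1)// -[RHS](rot _ _ ni i1)//.
apply: eq_integral => z _; case: z => x y.
by rewrite !complexME; congr (f (Complex _ _)); ring.
Qed.

End complex_lebesgue.

(** * The image of planar Lebesgue measure under the squared modulus *)

Section radial.
Context (R : realType).
Local Notation mu := (@lebesgue_measure R).
Local Notation disc a := [set z : R[i] | sqnorm z <= a%R].
Local Open Scope ereal_scope.

Lemma measurable_disc (a : R) : measurable (disc a).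
Proof.
have := @measurable_sqnorm R measurableT `]-oo, a]%classic (measurable_itv _).
by rewrite setTI set_itvE.
Qed.

Lemma complex_sfm_rect (A B : set R) : measurable A -> measurable B ->
  complex_sfm R [set z | A (complex.Re z) /\ B (complex.Im z)] = mu A * mu B.
Proof. by move=> mA mB; rewrite -product_measure1E. Qed.

Lemma measurable_complex_rect (A B : set R) : measurable A -> measurable B ->
  measurable [set z : R[i] | A (complex.Re z) /\ B (complex.Im z)].
Proof.
move=> mA mB; rewrite (_ : [set _ | _] =
  (@complex.Re R @^-1` A) `&` (@complex.Im R @^-1` B))//.
apply: measurableI; rewrite -[X in measurable X]setTI.
  exact: measurable_Re.
exact: measurable_Im.
Qed.

(** The dilation by sqrt a carries the unit disc to this one and multiplies areas by [a]. *)
Lemma disc_scale (a : R) : (0 < a)%R ->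
  complex_sfm R (disc a) = a%:E * complex_sfm R (disc 1).
Proof.
move=> a0; pose c := Num.sqrt a; have c0 : (0 < c)%R by rewrite sqrtr_gt0.
have c2 : (c ^+ 2 = a)%R by rewrite sqr_sqrtr// ltW.
pose f (z : R[i]) : \bar R := (\1_(disc a) z)%:E.
have mf : measurable_fun setT f.
  by apply/measurable_EFinP; exact/measurable_indic/measurable_disc.
have f0 z : 0 <= f z by rewrite lee_fin.
have := complex_integral_scale c0 mf f0.
rewrite c2 [in RHS]integral_indic; [|exact: measurableT|exact: measurable_disc].
rewrite setIT (eq_integral (fun z => (\1_(disc 1) z)%:E)); last first.
  move=> z _; rewrite /f; congr EFin; rewrite !indicE; congr (nat_of_bool _)%:R.
  apply/idP/idP; rewrite !inE /= sqnormM /sqnorm /= expr0n addr0 c2.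
    by rewrite -ler_pdivlMl// mulVf// gt_eqF.
  by rewrite -[X in _ -> (_ <= X)%R](mulr1 a) ler_pM2l.
rewrite integral_indic; [|exact: measurableT|exact: measurable_disc].
by rewrite setIT => ->; rewrite muleA -EFinM divff ?gt_eqF// mul1e.
Qed.

(** By monotonicity this settles all nonpositive squared radii, which [disc_scale] leaves out. *)
Lemma disc0 : complex_sfm R (disc 0) = 0.
Proof.
rewrite (_ : disc 0 =
    [set z | [set 0%R] (complex.Re z) /\ [set 0%R] (complex.Im z)]).
  by rewrite complex_sfm_rect// lebesgue_measure_set1 mul0e.
apply/seteqP; split => z /=; rewrite /sqnorm.
  rewrite -lerN2 oppr0 => z0.
  have : (complex.Re z ^+ 2 + complex.Im z ^+ 2 == 0)%R.
    by rewrite eq_le -oppr_ge0 z0 addr_ge0// sqr_ge0.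
  by rewrite paddr_eq0 ?sqr_ge0// !sqrf_eq0 => /andP[/eqP ? /eqP ?].
by move=> [-> ->]; rewrite expr0n addr0.
Qed.

(** The value pi is found only later, from a Gaussian. Until then one must be able to divide by this
    area, and a square inside the disc and one around it are enough for that. *)
Lemma disc1_fin : 0 < complex_sfm R (disc 1) < +oo.
Proof.
apply/andP; split.
  pose h : set R := `[0%R, 2^-1%R]%classic.
  have mh : measurable h by exact: measurable_itv.
  apply: (@lt_le_trans _ _ (complex_sfm R
      [set z | h (complex.Re z) /\ h (complex.Im z)])).
    rewrite complex_sfm_rect// lebesgue_measure_itv/= lte_fin invr_gt0 ltr0n.
    by rewrite -EFinB subr0 -EFinM lte_fin mulr_gt0.
  apply: le_measure; rewrite ?inE.
  - exact: measurable_complex_rect.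
  - exact: measurable_disc.
  - move=> z /=; rewrite /h /= !in_itv /= /sqnorm => -[/andP[a0 a1] /andP[b0 b1]].
    have := ler_pM a0 a0 a1 a1; have := ler_pM b0 b0 b1 b1.
    by rewrite -!expr2; lra.
pose h : set R := `[(-1)%R, 1%R]%classic.
have mh : measurable h by exact: measurable_itv.
apply: (@le_lt_trans _ _ (complex_sfm R
    [set z | h (complex.Re z) /\ h (complex.Im z)])); last first.
  by rewrite complex_sfm_rect// lebesgue_measure_itv/=; case: ifP;
    rewrite ?mul0e// -EFinB -EFinM ltry.
apply: le_measure; rewrite ?inE.
- exact: measurable_disc.
- exact: measurable_complex_rect.
- move=> z /=; rewrite /h /= !in_itv /= /sqnorm => z1.
  have a0 := sqr_ge0 (complex.Re z); have b0 := sqr_ge0 (complex.Im z).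
  by split; rewrite -ler_norml -(@ler_pXn2r _ 2%N)// ?nnegrE// expr1n
    real_normK ?num_real//; lra.
Qed.

(* The Lebesgue measure of the negative half-line completes the push-forward to
   a measure on R, to which uniqueness of the Lebesgue measure applies. *)
Lemma sqnorm_pushforward (A : set R) : measurable A ->
  A `<=` `[0%R, +oo[%classic ->
  complex_sfm R (@sqnorm R @^-1` A) = complex_sfm R (disc 1) * mu A.
Proof.
move=> mA A0; have /andP[k0 koo] := disc1_fin.
have kfin : complex_sfm R (disc 1) \is a fin_num by rewrite ge0_fin_numE// ltW.
pose k := fine (complex_sfm R (disc 1)).
have kE : complex_sfm R (disc 1) = k%:E by rewrite fineK.
have k1 : (0 < k)%R by rewrite -lte_fin -kE.
have ki : (0 <= k^-1)%R by rewrite invr_ge0 ltW.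
pose neg : set R := `]-oo, 0%R[%classic.
have mneg : measurable neg by exact: measurable_itv.
(* The maximum accounts for negative squared radii, whose disc is empty. *)
have DE (x : R) : complex_sfm R (disc x) = (Num.max x 0 * k)%:E.
  have [x0|x0] := ltP 0%R x.
    by rewrite disc_scale// kE -EFinM.
  rewrite mul0r; apply/eqP; rewrite eq_le measure_ge0 andbT -[leRHS]disc0.
  by apply: le_measure; rewrite ?inE;
    [exact: measurable_disc..|move=> z /= /le_trans; exact].
pose phi : R[i] -> measurableTypeR R := @sqnorm R.
have mphi : measurable_fun setT phi by exact: measurable_sqnorm.
suff H : mu A = measure_add (mscale (NngNum ki) (pushforward (complex_sfm R) phi))
    (mrestr mu mneg) A.
  rewrite (H mphi) measure_addE /mscale/= /mrestr.
  rewrite (_ : A `&` neg = set0); last first.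
    rewrite -subset0 => x [] /A0; rewrite /neg /= !in_itv/= andbT.
    by rewrite ltNge => ->.
  rewrite measure0 adde0 kE muleA -EFinM divff ?mul1e// gt_eqF//.
move=> m; apply: lebesgue_measure_unique => [_ [[a b]] _ <-|//].
rewrite [RHS]measure_addE.
change (mu `]a, b]%classic = (k^-1)%:E * complex_sfm R (phi @^-1` `]a, b]) +
  mu (`]a, b]%classic `&` neg)).
have [ba|ab] := leP b a.
  rewrite set_itv_ge ?preimage_set0; last by rewrite bnd_simp -leNgt.
  rewrite ?preimage_set0 set0I !measure0.
  by rewrite mule0 adde0.
rewrite (_ : phi @^-1` _ = disc b `\` disc a); last first.
  apply/seteqP; split => z /=; rewrite in_itv/= /phi.
    by move=> /andP[az zb]; split => //; apply/negP; rewrite -ltNge.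
  by move=> [zb /negP]; rewrite -ltNge zb andbT.
have Dfin : complex_sfm R (disc b) < +oo by rewrite DE ltry.
have -> : complex_sfm R (disc b `\` disc a) =
    complex_sfm R (disc b) - complex_sfm R (disc b `&` disc a).
  by apply: measureD => //; exact: measurable_disc.
rewrite (_ : disc b `&` disc a = disc a); last first.
  apply/seteqP; split => z /=; first by case.
  by move=> za; split => //; exact: le_trans za (ltW ab).
rewrite !DE -EFinB -EFinM.
have kk : (k^-1 * (Num.max b 0 * k - Num.max a 0 * k) =
    Num.max b 0 - Num.max a 0)%R.
  by rewrite -mulrBl mulrCA mulVf ?mulr1// gt_eqF.
(* Discs measure the part of ]a, b] to the right of 0 and [neg] the part to its left; the cases are
   the positions of 0. *)
rewrite kk; have [a0|a0] := leP 0%R a.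
  rewrite (_ : _ `&` neg = set0); last first.
    rewrite -subset0 => x []; rewrite /neg /= !in_itv/= => /andP[ax _].
    by apply/negP; rewrite -leNgt (le_trans a0)// ltW.
  rewrite measure0 adde0 lebesgue_measure_itv/= lte_fin ab -EFinB.
  by rewrite !max_l// (le_trans a0)// ltW.
have [b0|b0] := ltP b 0%R.
  rewrite (_ : _ `&` neg = `]a, b]%classic); last first.
    apply/seteqP; split => x /=; first by case.
    rewrite /neg /= !in_itv/= => /[dup] xab /andP[_ xb]; split => //.
    exact: le_lt_trans xb b0.
  by rewrite subrr add0e.
rewrite (_ : _ `&` neg = `]a, 0%R[%classic); last first.
  apply/seteqP; split => x /=; rewrite /neg /= !in_itv/=.
    by move=> [/andP[-> _] ->].
  by move=> /andP[-> x0]; rewrite x0 (le_trans (ltW x0)).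
rewrite !lebesgue_measure_itv/= !lte_fin ab a0 -!EFinB -EFinD; congr EFin.
ring.
Qed.

(** The constant is the area of the unit disc; left abstract, it can be identified by a single test
    function. *)
Let disc1_const : exists2 k : R, 0 <= k%:E & forall f : R -> \bar R,
  measurable_fun setT f -> (forall x, 0 <= f x) ->
  \int[complex_sfm R]_z f (sqnorm z) =
  k%:E * \int[mu]_(x in `[0%R, +oo[) f x.
Proof.
have /andP[k0 koo] := disc1_fin.
have kfin : complex_sfm R (disc 1) \is a fin_num by rewrite ge0_fin_numE// ltW.
exists (fine (complex_sfm R (disc 1))); first by rewrite fineK// ltW.
move=> f mf f0; rewrite fineK//.
pose D : set R := `[0%R, +oo[%classic.
have mD : measurable D by exact: measurable_itv.
pose phi : R[i] -> measurableTypeR R := @sqnorm R.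
have mphi : measurable_fun setT phi by exact: measurable_sqnorm.
have phiD : phi @^-1` D = setT.
  by apply/seteqP; split => // z _; rewrite /D /= in_itv/= andbT sqnorm_ge0.
rewrite -phiD -(@ge0_integral_pushforward _ _ _ _ _ phi mphi (complex_sfm R))//;
  last exact: measurable_funTS.
pose kn := NngNum (fine_ge0 (ltW k0)).
transitivity (\int[mscale kn mu]_(x in D) f x).
  apply: eq_measure_integral => B mB BD.
  transitivity (complex_sfm R (disc 1) * mu B); first exact: sqnorm_pushforward.
  by rewrite -[X in X * _](fineK kfin).
rewrite ge0_integral_mscale//; last exact: measurable_funTS.
by rewrite -[in RHS](fineK kfin).
Qed.

(* The constant is found by integrating a Gaussian. *)
Lemma complex_integral_sqnorm (f : R -> \bar R) :
  measurable_fun setT f -> (forall x, 0 <= f x) ->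
  \int[complex_sfm R]_z f (sqnorm z) = pi%:E * \int[mu]_(x in `[0%R, +oo[) f x.
Proof.
have [k k0 kE] := disc1_const.
suff -> : pi = k by exact: kE.
pose g (x : R) : \bar R := (expR (- x))%:E.
have mg : measurable_fun setT g.
  by apply/measurable_EFinP; apply: measurableT_comp => //; exact: measurable_funN.
have g0 x : 0 <= g x by rewrite lee_fin expR_ge0.
have := kE g mg g0.
(* In the variable |z|^2 the Gaussian is the exponential density of rate 1; in Cartesian coordinates
   it factors into two integrals equal to sqrt pi. *)
rewrite (_ : \int[mu]_(x in _) g x = 1); last first.
  rewrite integral_mkcond -(integral_exponential_pdf (@ltr01 R)).
  apply: eq_integral => x _; rewrite /exponential_pdf !patchE; case: ifPn => // _.
  by rewrite mulN1r mul1r.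
rewrite mule1 complex_integralE//; last exact: measurableT_comp (@measurable_sqnorm R).
have -> : \int[mu]_x \int[mu]_y g (sqnorm (Complex x y)) =
    \int[mu]_x ((Num.sqrt pi)%:E * (gauss_fun x)%:E).
  apply: eq_integral => x _; rewrite -integralT_gauss -ge0_integralZr//.
  - apply: eq_integral => y _; rewrite -EFinM /g /gauss_fun -expRD /sqnorm /=.
    by rewrite opprD addrC.
  - by apply/measurable_EFinP; exact: measurable_gauss_fun.
  - by move=> y _; rewrite lee_fin gauss_fun_ge0.
  - by rewrite lee_fin gauss_fun_ge0.
rewrite ge0_integralZl//; last 2 first.
- by apply/measurable_EFinP; exact: measurable_gauss_fun.
- by move=> y _; rewrite lee_fin gauss_fun_ge0.
by rewrite integralT_gauss -EFinM -expr2 sqr_sqrtr ?pi_ge0// => -[].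
Qed.

End radial.

(** * Polar coordinates *)

Section circle.
Context (R : realType).
Local Notation mu := (@lebesgue_measure R).
Local Notation T := (2 * pi : R).

Definition cis (t : R) : R[i] := Complex (cos t) (sin t).

Lemma cisD s t : cis (s + t) = cis s * cis t.
Proof. by rewrite /cis complexME cosD sinD; congr Complex; ring. Qed.

Lemma cisX t n : cis t ^+ n = cis (n%:R * t).
Proof.
elim: n => [|n IH]; first by rewrite expr0 mul0r /cis cos0 sin0.
by rewrite exprS IH -cisD; congr cis; rewrite -natr1; ring.
Qed.

Lemma cis_periodic t : cis (t + T) = cis t.
Proof. by rewrite /cis mulr_natl sinD2pi cosD2pi. Qed.

Lemma sqnorm_cis t : sqnorm (cis t) = 1.
Proof. by rewrite /sqnorm /= cos2Dsin2. Qed.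

Lemma measurable_cis : measurable_fun setT cis.
Proof.
apply: measurable_Complex; apply: continuous_measurable_fun.
  exact: continuous_cos.
exact: continuous_sin.
Qed.

Lemma polar_exists (z : R[i]) :
  exists2 t : R, 0 <= t <= T & z = (Num.sqrt (sqnorm z))%:C%C * cis t.
Proof.
have key (w : R[i]) : sqnorm w = 1 -> exists2 t : R, 0 <= t <= T & w = cis t.
  case: w => c s; rewrite /sqnorm /= => cs.
  have c1 : -1 <= c <= 1.
    rewrite -ler_norml -(@ler_pXn2r _ 2%N)// ?nnegrE// expr1n.
    by rewrite real_normK ?num_real// -cs lerDl sqr_ge0.
  have s2 : s ^+ 2 = 1 - c ^+ 2 by rewrite -cs; ring.
  have /andP[a0 api] : 0 <= acos c <= pi by rewrite acos_ge0// acos_lepi.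
  have pi0 := @pi_gt0 R.
  (* The arccosine reaches the upper half of the circle, and 2 pi minus it the lower half. *)
  have [s0|s0] := leP 0 s.
    exists (acos c); first by apply/andP; split => //; lra.
    rewrite /cis acosK ?in_itv//= sin_acos// -s2 sqrtr_sqr ger0_norm//.
  exists (2 * pi - acos c); first by apply/andP; split; lra.
  rewrite addrC /cis mulr_natl cosD2pi sinD2pi cosN sinN.
  by rewrite acosK ?in_itv//= sin_acos// -s2 sqrtr_sqr ltr0_norm// opprK.
have [z0|z0] := eqVneq (sqnorm z) 0.
  exists 0; first by rewrite lexx mulr_ge0// pi_ge0.
  rewrite z0 sqrtr0 mul0r; move: z0; rewrite /sqnorm => /eqP.
  rewrite paddr_eq0 ?sqr_ge0// !sqrf_eq0 => /andP[/eqP a /eqP b].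
  by case: z a b => ? ? /= -> ->.
have zp : 0 < sqnorm z by rewrite lt_neqAle eq_sym z0 sqnorm_ge0.
pose r := Num.sqrt (sqnorm z).
have r0 : 0 < r by rewrite sqrtr_gt0.
have [|t t01 tE] := key (r^-1%:C%C * z).
  rewrite sqnormM {1}/sqnorm /= expr0n addr0 exprVn sqr_sqrtr ?sqnorm_ge0//.
  by rewrite mulVf.
exists t => //; rewrite -tE mulrA -/r -rmorphM /= mulfV ?gt_eqF// mul1r//.
Qed.

Local Open Scope ereal_scope.

Lemma ge0_integral_translation_set (e : R) (D : set R) (h : R -> \bar R) :
  measurable D -> measurable_fun setT h -> (forall x, 0 <= h x) ->
  \int[mu]_(x in [set x | D (x + e)%R]) h (x + e)%R = \int[mu]_(x in D) h x.
Proof.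
move=> mD mh h0; rewrite integral_mkcond [RHS]integral_mkcond.
rewrite -[RHS](ge0_integral_translation e)//.
- by apply/(measurable_restrictT _ _).1 => //; exact: measurable_funTS.
- by move=> x; rewrite patchE; case: ifP.
Qed.

(** The shifted period is cut at [T], and the piece beyond is moved back by one period. *)
Lemma ge0_integral_periodic (psi : R) (h : R -> \bar R) :
  (0 <= psi <= T)%R -> (forall t, h (t + T)%R = h t) ->
  measurable_fun setT h -> (forall x, 0 <= h x) ->
  \int[mu]_(t in `[0%R, T]) h (t + psi)%R = \int[mu]_(t in `[0%R, T]) h t.
Proof.
move=> /andP[psi0 psiT] hT mh h0.
have mhD D : measurable_fun D h by exact: measurable_funTS.
have -> : \int[mu]_(t in `[0%R, T]) h (t + psi)%R =
    \int[mu]_(t in `[psi, (T + psi)%R]) h t.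
  rewrite -[RHS](ge0_integral_translation_set psi)//; congr integral.
  by apply/seteqP; split => t /=; rewrite !in_itv/= lerD2r lerDr.
(* With half-open intervals the pieces concatenated below are disjoint; end points have measure
   zero. *)
rewrite -!integral_itv_bndo_bndc//.
have cat (a b c : R) : (a <= b <= c)%R ->
    \int[mu]_(t in `[a, c[) h t =
    \int[mu]_(t in `[a, b[) h t + \int[mu]_(t in `[b, c[) h t.
  move=> /andP[ab bc]; rewrite -ge0_integral_setU//=.
  - congr integral; rewrite -itv_bndbnd_setU// bnd_simp//.
  - exact: mhD.
  - apply/eqP; rewrite -subset0 => x [] /=.
    by rewrite !in_itv/= => /andP[_ xb] /andP[]; rewrite leNgt xb.
rewrite (cat psi T (T + psi)%R) ?psiT ?lerDl//.
rewrite [RHS](cat 0%R psi T) ?psi0// addeC; congr (_ + _).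
rewrite -[LHS](ge0_integral_translation_set T)//.
rewrite (_ : [set x | _] = `[0%R, psi[%classic); last first.
  by apply/seteqP; split => t /=; rewrite !in_itv/= lerDr [(T + psi)%R]addrC ltrD2r.
by apply: eq_integral => t _.
Qed.

(** The argument of [z] is a shift of the angle, which an integral over a full period does not
    see. *)
Lemma circle_integral_rotation (z : R[i]) (g : R[i] -> \bar R) :
  measurable_fun setT g -> (forall x, 0 <= g x) ->
  \int[mu]_(t in `[0%R, T]) g (cis t * z)%R =
  \int[mu]_(t in `[0%R, T]) g ((Num.sqrt (sqnorm z))%:C%C * cis t)%R.
Proof.
move=> mg g0; have [psi psiT zE] := polar_exists z.
pose h t := g ((Num.sqrt (sqnorm z))%:C%C * cis t)%R.
transitivity (\int[mu]_(t in `[0%R, T]) h (t + psi)%R).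
  by apply: eq_integral => t _; rewrite {1}zE /h cisD mulrCA.
rewrite ge0_integral_periodic//.
- by move=> t; rewrite /h cis_periodic.
- apply: (measurableT_comp mg); apply: measurable_complexM => //.
  exact: measurable_cis.
- by move=> t; exact: g0.
Qed.

End circle.

(** * The M-th power under a radial density *)

Section polar.
Context (R : realType).
Local Notation mu := (@lebesgue_measure R).
Local Notation T := (2 * pi : R).
Local Open Scope ereal_scope.

Definition plane_sfm : {sigma_finite_measure
    set (measurableTypeR R * measurableTypeR R)%type -> \bar R} :=
  product_sfm mu mu.

(** The first coordinate stands for |z|^2, hence the exponent M / 2 for the modulus of the M-th
    power. *)
Definition polar_power (M : nat) (xt : R * R) : R[i] :=
  (real_complex R (xt.1 `^ (M%:R / 2)) * cis xt.2)%R.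

(** The factor 1/2 is the pi of the radial formula times the density 1 / (2 pi) of a uniform
    angle. *)
Definition polar_weight (w : R -> \bar R) (xt : R * R) : \bar R :=
  (w \_ `[0%R, +oo[) xt.1 * (2^-1 * \1_(`[0%R, T]%classic : set R) xt.2)%:E.

Lemma measurable_polar_power M :
  measurable_fun (setT : set (R * R)) (polar_power M).
Proof.
apply: measurable_complexM; last exact: (measurableT_comp (@measurable_cis R)).
apply: measurable_Complex => //.
exact: (measurableT_comp (measurable_powR _)).
Qed.

Lemma measurable_polar_weight (w : R -> \bar R) :
  measurable_fun (`[0%R, +oo[%classic : set R) w ->
  measurable_fun (setT : set (R * R)) (polar_weight w).
Proof.
move=> mw; apply: emeasurable_funM.
  apply: (@measurableT_comp _ _ _ _ _ _ (w \_ `[0%R, +oo[)) => //.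
  by apply/(measurable_restrictT _ _).1.
apply/measurable_EFinP; apply: measurable_funM => //.
by apply: (measurableT_comp (measurable_indic _)) => //; exact: measurable_itv.
Qed.

Lemma polar_weight_ge0 (w : R -> \bar R) xt :
  (forall x, (0 <= x)%R -> 0 <= w x) -> 0 <= polar_weight w xt.
Proof.
move=> w0; rewrite mule_ge0// patchE; case: ifPn => //.
by rewrite inE /= in_itv/= andbT => /w0.
Qed.

Lemma normc_power_sqnorm (z : R[i]) M :
  (Num.sqrt (sqnorm (z ^+ M)) = sqnorm z `^ (M%:R / 2))%R.
Proof.
by rewrite sqnormX powRrM powR_mulrn ?sqnorm_ge0// powR12_sqrt// exprn_ge0// sqnorm_ge0.
Qed.

(* Averaging over the rotations of angle alpha / M turns z ^ M into a point
   uniformly distributed on its circle. *)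
Lemma complex_integral_power (M : nat) (w : R -> \bar R) (g : R[i] -> \bar R) :
  (0 < M)%N -> measurable_fun (`[0%R, +oo[%classic : set R) w ->
  (forall x, (0 <= x)%R -> 0 <= w x) ->
  measurable_fun setT g -> (forall z, 0 <= g z) ->
  \int[complex_sfm R]_z (g (z ^+ M)%R * w (sqnorm z)) =
  \int[plane_sfm]_xt (g (polar_power M xt) * polar_weight w xt).
Proof.
move=> M0 mw w0 mg g0.
(* Nothing is assumed of [w] on negative numbers, so it is extended by 0; squared moduli do not see
   the change. *)
pose w' := w \_ `[0%R, +oo[%classic.
have mw' : measurable_fun setT w' by apply/(measurable_restrictT _ _).1.
have w'0 x : 0 <= w' x.
  by rewrite /w' patchE; case: ifPn => //; rewrite inE /= in_itv/= andbT => /w0.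
have ww' z : w (sqnorm z) = w' (sqnorm z).
  by rewrite /w' patchE ifT// inE /= in_itv/= andbT sqnorm_ge0.
pose c : R -> \bar R := fun t => (\1_(`[0%R, T]%classic : set R) t)%:E.
have mc : measurable_fun setT c.
  by apply/measurable_EFinP; apply: measurable_indic; exact: measurable_itv.
have c0 t : 0 <= c t by rewrite lee_fin.
have cE (h : R -> \bar R) :
    \int[mu]_(t in `[0%R, T]) h t = \int[mu]_t (h t * c t).
  by rewrite integral_mkcond epatch_indic.
pose G (r : R) := \int[mu]_t (g (r%:C%C * cis t)%R * c t).
pose F1 (rt : measurableTypeR R * measurableTypeR R) :=
  g (rt.1%:C%C * cis rt.2)%R * c rt.2.
have mF : measurable_fun setT F1.
  apply: emeasurable_funM; last exact: (measurableT_comp mc).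
  apply: (measurableT_comp mg); apply: measurable_complexM.
    exact: measurable_Complex.
  exact: (measurableT_comp (@measurable_cis R)).
have mG : measurable_fun setT G.
  apply: (measurable_fun_fubini_tonelli_F (m2 := mu) F1 mF) => rt.
  by rewrite mule_ge0.
have G0 r : 0 <= G r by apply: integral_ge0 => t _; rewrite mule_ge0.
have mp : measurable_fun setT (fun x : R => (x `^ (M%:R / 2))%R).
  exact: measurable_powR.
pose H (x : R) := G (x `^ (M%:R / 2))%R.
have mH : measurable_fun setT H by exact: (measurableT_comp mG).
(* Both sides are reduced to the radial integral of [w'] against [H], the integral of [g] over the
   circle whose radius is the power M / 2 of [x]. *)
transitivity ((2^-1)%:E * \int[mu]_x (w' x * H x)); last first.
  rewrite fubini_tonelli1/=; last 2 first.
  - apply: emeasurable_funM.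
      exact: (measurableT_comp mg (measurable_polar_power M)).
    exact: measurable_polar_weight.
  - by move=> xt; rewrite mule_ge0// polar_weight_ge0.
  rewrite -ge0_integralZl//; last 2 first.
  - exact: emeasurable_funM.
  - by move=> x _; rewrite mule_ge0// G0.
  apply: eq_integral => x _; rewrite muleA -ge0_integralZl//; last 3 first.
  - exact: (measurableT_comp mF (pair1_measurable _)).
  - by move=> t _; rewrite mule_ge0.
  - by rewrite mule_ge0// lee_fin.
  apply: eq_integral => t _; rewrite /polar_power /polar_weight /=.
  by rewrite EFinM muleCA -!muleA; congr (_ * _); rewrite muleCA.
have T0 : (0 < T)%R by rewrite mulr_gt0// pi_gt0.
(* The factor [T] makes room for an extra integration over an angle on which the integral does not
   depend. *)
suff S : T%:E * \int[complex_sfm R]_z (g (z ^+ M)%R * w (sqnorm z)) =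
    pi%:E * \int[mu]_x (w' x * H x).
  rewrite (_ : 2^-1 = T^-1 * pi :> R)%R; last first.
    by rewrite invfM -mulrA mulVf ?mulr1// gt_eqF// pi_gt0.
  by rewrite EFinM -muleA -S muleA -EFinM mulVf ?gt_eqF// mul1e.
have IT : \int[mu]_t c t = T%:E.
  rewrite integral_indic//=.
  rewrite setIT lebesgue_measure_itv/= lte_fin T0 -EFinB subr0//.
pose F (z : R[i]) := g (z ^+ M)%R * w' (sqnorm z).
have mFz : measurable_fun setT F.
  apply: emeasurable_funM.
    by apply: (measurableT_comp mg); exact: measurable_complexX.
  exact: (measurableT_comp mw' (@measurable_sqnorm R)).
have F0 z : 0 <= F z by rewrite mule_ge0.
pose F2 (az : R * R[i]) := g (cis az.1 * az.2 ^+ M)%R * w' (sqnorm az.2) * c az.1.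
have mF2 : measurable_fun (setT : set (R * R[i])) F2.
  apply: emeasurable_funM; last exact: (measurableT_comp mc).
  apply: emeasurable_funM.
    apply: (measurableT_comp mg); apply: measurable_complexM.
      exact: (measurableT_comp (@measurable_cis R)).
    by apply: measurable_complexX; exact: measurable_snd.
  apply: (measurableT_comp mw'); apply: (measurableT_comp (@measurable_sqnorm R)).
  exact: measurable_snd.
have F20 az : 0 <= F2 az by rewrite !mule_ge0.
transitivity (\int[mu]_a \int[complex_sfm R]_z F2 (a, z)).
  rewrite -IT -ge0_integralZr//; last first.
    by apply: integral_ge0 => z _; rewrite ww' mule_ge0.
  apply: eq_integral => a _; rewrite muleC.
  have -> : \int[complex_sfm R]_z (g (z ^+ M)%R * w (sqnorm z)) =
      \int[complex_sfm R]_z F (cis (a / M%:R) * z)%R.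
    rewrite (complex_integral_rotation _ mFz F0) ?sqnorm_cis//.
    by apply: eq_integral => z _; rewrite ww'.
  rewrite -ge0_integralZr//; last first.
    apply: (measurableT_comp mFz); apply: measurable_complexM => //.
  apply: eq_integral => z _; rewrite /F /F2 /= sqnormM sqnorm_cis mul1r.
  by rewrite exprMn cisX [(M%:R * _)%R]mulrC divfK// pnatr_eq0 -lt0n.
rewrite (fubini_tonelli (m1 := mu) (m2 := complex_sfm R) F2 mF2 F20).
(* After integration over the extra angle only the modulus of [z ^+ M] is left, so the integrand is
   a function of |z|^2. *)
transitivity (\int[complex_sfm R]_z (w' (sqnorm z) * H (sqnorm z))).
  apply: eq_integral => z _; rewrite /H -normc_power_sqnorm.
  transitivity (w' (sqnorm z) * \int[mu]_t (g (cis t * z ^+ M)%R * c t)).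
    rewrite -ge0_integralZl//.
    - by apply: eq_integral => t _; rewrite /F2 /= muleCA muleA.
    - apply: emeasurable_funM => //; apply: (measurableT_comp mg).
      by apply: measurable_complexM => //; exact: measurable_cis.
    - by move=> t _; rewrite mule_ge0.
  by congr (_ * _); rewrite -cE circle_integral_rotation// cE.
rewrite (complex_integral_sqnorm (f := fun x => w' x * H x))//.
- congr (_ * _); rewrite integral_mkcond; apply: eq_integral => x _.
  rewrite patchE; case: ifPn => // xD; rewrite /w' patchE (negbTE xD) mul0e//.
- exact: emeasurable_funM.
- by move=> x; rewrite mule_ge0// G0.
Qed.

End polar.

(** * The beta ensemble as a mixture *)

Section vandermonde_degree.
Context (N : nat).
Local Notation P := (mpoly.mpoly N int).

(** A bound on the degree in one variable. Being an upper bound on the support, it is insensitive to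
    cancellations. *)
Let degle (k : 'I_N) (d : nat) (q : P) :=
  forall m, m \in mpoly.msupp q -> (mpoly.fun_of_multinom m k <= d)%N.

Let degleM k d1 d2 (q1 q2 : P) :
  degle k d1 q1 -> degle k d2 q2 -> degle k (d1 + d2) (q1 * q2).
Proof.
move=> h1 h2 m /mpoly.msuppM_le /allpairsP[[m1 m2] /= [m1q m2q ->]].
by rewrite mpoly.mnmDE leq_add// ?h1// h2.
Qed.

Let degle1 k : degle k 0 1.
Proof. by move=> m; rewrite mpoly.msupp1 inE => /eqP ->; rewrite mpoly.mnm0E. Qed.

Let degleX k d (q : P) n : degle k d q -> degle k (d * n) (q ^+ n).
Proof.
move=> h; elim: n => [|n IH]; first by rewrite muln0 expr0; exact: degle1.
by rewrite mulnS exprS; exact: degleM.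
Qed.

Let degle_prod k (s : seq 'I_N) (d : 'I_N -> nat) (q : 'I_N -> P) :
  (forall i, degle k (d i) (q i)) ->
  degle k (\sum_(i <- s) d i) (\prod_(i <- s) q i).
Proof.
move=> h; elim: s => [|i s IH]; first by rewrite !big_nil; exact: degle1.
by rewrite !big_cons; exact: degleM.
Qed.

Let degle_mul_sign k d (q : P) (b : bool) : degle k d q -> degle k d ((-1) ^+ b * q).
Proof.
case: b => h; last by rewrite expr0 mul1r.
by rewrite expr1 mulN1r => m; rewrite (perm_mem (mpoly.msuppN _)); exact: h.
Qed.

Let degle_var k j : degle k (j == k) (mpoly.mpolyX int (mpoly.mnm1 j)).
Proof. by move=> m; rewrite mpoly.msuppX inE => /eqP ->; rewrite mpoly.mnm1E. Qed.

(** In the term of the determinant given by a permutation s, the variable T_k occurs in one factor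
    only, with the exponent i such that s i = k, and i <= N - 1. *)
Lemma vandermonde_degree_le p (m : mpoly.multinom N) (k : 'I_N) :
  m \in mpoly.msupp (vandermonde_poly N ^+ p) ->
  (mpoly.fun_of_multinom m k <= (N - 1) * p)%N.
Proof.
apply: (@degleX k) => {}m; rewrite /vandermonde_poly /determinant.
move=> /mpoly.msupp_sum_le /flattenP[t /mapP[/= s _ ->]].
apply: degle_mul_sign => {}m mE.
pose s' : perm.perm_type 'I_N := s; pose f i := perm.fun_of_perm s' i.
have dm : (mpoly.fun_of_multinom m k <= \sum_(i < N) ((f i == k) * i))%N.
  move: m mE; apply: degle_prod => i.
  by rewrite !mxE; apply: degleX; exact: degle_var.
apply: (leq_trans dm); rewrite (bigD1 (perm.fun_of_perm (perm.perm_inv s') k))//=.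
rewrite {1}/f perm.permKV eqxx mul1n big1 ?addn0.
  by rewrite -ltnS subn1 prednK// (leq_ltn_trans _ (ltn_ord k)).
move=> i; apply: contraNeq; rewrite muln_eq0 negb_or eqb0 negbK.
by move=> /andP[/eqP <- _]; rewrite /f perm.permK.
Qed.

End vandermonde_degree.

(** * Expansion of the power of the Vandermonde product *)

Section vandermonde_expansion.
Context (R : realType) (N p M : nat).
Hypothesis hM : ((N - 1) * p + 1 <= M)%N.

(** By the degree bound these are the only exponents that can have a nonzero coefficient, so sums
    over Z^N become sums over a finite type. *)
Definition latent_index (e : {ffun 'I_N -> 'I_M}) : {ffun 'I_N -> int} :=
  [ffun i => (e i : nat)%:Z].

Lemma latent_index_inj : injective latent_index.
Proof.
move=> e f /ffunP ef; apply/ffunP => i; apply/val_inj.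
by have := ef i; rewrite !ffunE => -[].
Qed.

Let mon (e : {ffun 'I_N -> 'I_M}) : mpoly.multinom N :=
  mpoly.Multinom [tuple `|latent_index e i|%N | i < N].

Let monE e i : mpoly.fun_of_multinom (mon e) i = e i :> nat.
Proof. by rewrite /mon mpoly.multinomE tnth_mktuple ffunE. Qed.

Let coefE e : vandermonde_coef p (latent_index e) =
  mpoly.mcoeff (mon e) (vandermonde_poly N ^+ p).
Proof.
by rewrite /vandermonde_coef ifT//; apply/forallP => i; rewrite ffunE.
Qed.

Lemma vandermonde_coef_eq0 u : u \notin codom latent_index ->
  vandermonde_coef p u = 0.
Proof.
move=> ucod; rewrite /vandermonde_coef; case: ifPn => // /forallP u0.
apply/eqP; rewrite mpoly.mcoeff_eq0; apply: contra ucod => umem.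
have uM i : (`|u i| < M)%N.
  apply: leq_trans hM; rewrite addn1 ltnS.
  have := vandermonde_degree_le i umem.
  by rewrite mpoly.multinomE tnth_mktuple.
apply/codomP; exists [ffun i => Ordinal (uM i)].
by apply/ffunP => i; rewrite !ffunE /= gez0_abs.
Qed.

Lemma vandermonde_expansion (z : 'I_N -> R[i]) :
  (\prod_(i < N) \prod_(j < N | (i < j)%N) (z j - z i)) ^+ p =
  \sum_(e : {ffun 'I_N -> 'I_M})
    (vandermonde_coef p (latent_index e))%:~R * \prod_(i < N) z i ^+ e i.
Proof.
pose q := vandermonde_poly N.
pose ev : {rmorphism mpoly.mpoly N int -> R[i]} := mpoly.mmap (intmul (1 : R[i])) z.
transitivity (ev (q ^+ p)).
  rewrite rmorphXn /q /vandermonde_poly det_Vandermonde rmorph_prod.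
  congr (_ ^+ _); apply: eq_bigr => i _; rewrite rmorph_prod.
  apply: eq_bigr => j _; rewrite rmorphB /= !mxE.
  by rewrite /ev !mpoly.mmapX !mpoly.mmap1U.
rewrite /ev /mpoly.mmap.
pose F (m : mpoly.multinom N) : R[i] :=
  (mpoly.mcoeff m (q ^+ p))%:~R * \prod_(i < N) z i ^+ mpoly.fun_of_multinom m i.
have mon_inj : injective mon.
  move=> e f ef; apply/ffunP => i; apply/val_inj.
  by rewrite /= -monE ef monE.
transitivity (\sum_(m <- mpoly.msupp (q ^+ p)) F m).
  by apply: eq_bigr => m _.
rewrite (eq_bigr (fun e => F (mon e))); last first.
  move=> e _; rewrite /F coefE; congr (_ * _).
  by apply: eq_bigr => i _; rewrite monE.
(* Exponents outside the support contribute 0; the others enumerate the support without repetition,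
   by the degree bound. *)
rewrite [RHS](bigID (fun e => mon e \in mpoly.msupp (q ^+ p)))/= [X in _ = _ + X]big1.
  rewrite addr0 -[RHS]big_filter -[RHS](big_map mon xpredT F); apply: perm_big.
  apply: uniq_perm.
  - exact: mpoly.msupp_uniq.
  - by rewrite map_inj_uniq// filter_uniq// index_enum_uniq.
  move=> m; apply/idP/mapP; last first.
    by move=> [e]; rewrite mem_filter => /andP[+ _] ->.
  move=> mq; have mM i : (mpoly.fun_of_multinom m i < M)%N.
    by apply: leq_trans hM; rewrite addn1 ltnS; exact: vandermonde_degree_le.
  have mE : m = mon [ffun i => Ordinal (mM i)].
    by apply/mpoly.mnmP => i; rewrite monE ffunE.
  exists [ffun i => Ordinal (mM i)] => //.
  by rewrite mem_filter mem_index_enum andbT -mE.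
by move=> e; rewrite -mpoly.mcoeff_eq0 /F => /eqP ->; rewrite mul0r.
Qed.

End vandermonde_expansion.

(** * Orthogonality over the M-th roots of unity *)

Section parseval.
Context (R : realType) (M : nat) (M0 : (0 < M)%N).
Local Notation T := (2 * pi : R).
Local Notation tau := (T / M%:R).

Lemma sqnormE (z : R[i]) : (sqnorm z)%:C%C = z * conjc z.
Proof. by case: z => a b; rewrite /= complexME /sqnorm /=; congr Complex; ring. Qed.

Lemma conjc_cis (t : R) : conjc (cis t) = cis (- t).
Proof. by rewrite /cis /= cosN sinN. Qed.

(** The cosine is injective only on [0, pi]: negative angles are conjugated, and an angle beyond pi
    is replaced by 2 pi minus it, which leads to a contradiction. *)
Lemma cis_eq1 (t : R) : - T < t < T -> cis t = 1 -> t = 0.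
Proof.
wlog t0 : t / 0 <= t => [wh|] /andP[tl tr] t1.
  have [t0|t0] := leP 0 t; first by apply: wh => //; rewrite tl.
  apply/eqP; rewrite -oppr_eq0; apply/eqP; apply: wh.
  - by rewrite oppr_ge0 ltW.
  - by rewrite ltrN2 tr ltrNl tl.
  - by rewrite -conjc_cis t1 conjc1.
have pi0 := @pi_gt0 R.
have c1 : cos t = cos 0 by have := congr1 (@complex.Re R) t1; rewrite /= cos0.
have [tp|tp] := leP t pi.
  by apply: cos_inj => //; rewrite in_itv/=; apply/andP; split; lra.
have c2 : cos (T - t) = cos 0 by rewrite addrC mulr_natl cosD2pi cosN.
have : T - t = 0 by apply: cos_inj => //; rewrite in_itv/=; apply/andP; split; lra.
lra.
Qed.

(** For a != b this is a geometric sum whose ratio [x] is an M-th root of unity, different from 1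
    because |a - b| < M. *)
Lemma cis_orthogonal (a b : 'I_M) :
  \sum_(k < M) (cis (k%:R * tau) ^+ a * conjc (cis (k%:R * tau)) ^+ b) =
  M%:R *+ (a == b).
Proof.
pose x := cis ((a%:R - b%:R) * tau).
have Mn0 : M%:R != 0 :> R by rewrite pnatr_eq0 -lt0n.
have xk k : cis (k%:R * tau) ^+ a * conjc (cis (k%:R * tau)) ^+ b = x ^+ k.
  by rewrite conjc_cis !cisX -cisD; congr cis; ring.
under eq_bigr do rewrite xk.
have [ab|ab] := eqVneq a b.
  rewrite /x ab subrr mul0r /cis cos0 sin0 (eq_bigr (fun=> 1)).
    by rewrite sumr_const card_ord.
  by move=> k _; rewrite expr1n.
have xM : x ^+ M = 1.
  rewrite /x cisX mulrCA [M%:R * _]mulrC divfK//.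
  have per (m : nat) : cis (m%:R * T) = 1.
    by rewrite -cisX /cis mulr_natl cos2pi sin2pi expr1n.
  rewrite mulrBl cisD per mul1r.
  by rewrite -conjc_cis per conjc1.
have x1 : x != 1.
  apply/eqP => x1; have : (a%:R - b%:R) * tau = 0 :> R.
    apply: cis_eq1 x1; rewrite mulrA -ltr_norml normrM normfV.
    rewrite normr_nat ltr_pdivrMr ?ltr0n// normrM.
    rewrite (gtr0_norm (two_pi_gt0 R)) mulrC ltr_pM2l ?two_pi_gt0//.
    rewrite ltr_norml; have := ltn_ord a; have := ltn_ord b.
    rewrite -!(ltr_nat R); have := ler0n R a; have := ler0n R b.
    by move=> b0 a0 bM aM; apply/andP; split; lra.
  move/eqP; rewrite mulf_eq0 subr_eq0 eqr_nat val_eqE (negbTE ab)/=.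
  by rewrite mulf_eq0 invr_eq0 (negbTE Mn0) orbF gt_eqF// two_pi_gt0.
have := subrX1 x M; rewrite xM subrr => /esym/eqP.
by rewrite mulf_eq0 subr_eq0 (negbTE x1)/= => /eqP.
Qed.

(** The squared modulus is a double sum over [e] and [f]. By distributivity the sum over [k] becomes
    a product over coordinates of orthogonality relations, and a coordinate where [e] and [f] differ
    gives a zero factor. *)
Lemma parseval N (c : {ffun 'I_N -> 'I_M} -> R) (z : 'I_N -> R[i]) :
  \sum_(k : {ffun 'I_N -> 'I_M})
    sqnorm (\sum_e (c e)%:C%C * \prod_(i < N) (cis ((k i)%:R * tau) * z i) ^+ e i)
  = (M%:R ^+ N) * \sum_e (c e ^+ 2 * \prod_(i < N) sqnorm (z i) ^+ e i).
Proof.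
apply: complexI; rewrite rmorph_sum /=.
pose G i (e f : {ffun 'I_N -> 'I_M}) (k : 'I_M) : R[i] :=
  cis (k%:R * tau) ^+ e i * conjc (cis (k%:R * tau)) ^+ f i.
pose Z (e f : {ffun 'I_N -> 'I_M}) : R[i] :=
  \prod_(i < N) (z i ^+ e i * conjc (z i) ^+ f i).
transitivity (\sum_(k : {ffun 'I_N -> 'I_M}) \sum_e \sum_f
    (c e * c f)%:C%C * Z e f * \prod_(i < N) G i e f (k i)).
  apply: eq_bigr => k _; rewrite sqnormE rmorph_sum big_distrlr /=.
  apply: eq_bigr => e _; apply: eq_bigr => f _.
  have cM (x : R) y : conjc (x%:C%C * y) = x%:C%C * conjc y.
    by case: y => s t; rewrite [LHS]/= [RHS]complexME; congr Complex; ring.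
  rewrite cM rmorph_prod mulrACA.
  rewrite -(rmorphM (real_complex R)) -[RHS]mulrA.
  congr (_ * _); rewrite -!big_split /=; apply: eq_bigr => i _.
  by rewrite rmorphXn /= rmorphM /= !exprMn /G; ring.
rewrite exchange_big /= rmorphM rmorph_sum mulr_sumr; apply: eq_bigr => e _.
rewrite exchange_big /= (bigD1 e)//= [X in _ + X]big1 ?addr0; last first.
  move=> f fe; rewrite -mulr_sumr -(bigA_distr_bigA (fun i => G i e f)).
  have [i ei] : exists i, e i != f i.
    apply/existsP; apply: contraR fe; rewrite negb_exists => /forallP h.
    by apply/eqP/ffunP => i; have := h i; rewrite negbK => /eqP.
  by rewrite (bigD1 i)//= cis_orthogonal (negbTE ei) mulr0n mul0r mulr0.
rewrite -mulr_sumr -(bigA_distr_bigA (fun i => G i e e)).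
rewrite (eq_bigr (fun=> M%:R)); last first.
  by move=> i _; rewrite cis_orthogonal eqxx mulr1n.
rewrite prodr_const card_ord rmorphXn rmorph_nat mulrC; congr (_ * _).
rewrite -expr2 [RHS]rmorphM; congr (_ * _); rewrite rmorph_prod; apply: eq_bigr => i _.
by rewrite rmorphXn /= sqnormE exprMn.
Qed.

End parseval.

Lemma measurable_expeR (R : realType) : measurable_fun setT (@expeR R).
Proof.
rewrite (_ : expeR = fun x => if x == +oo%E then +oo%E else
    if x == -oo%E then 0%E else (expR (fine x))%:E); last first.
  by apply/funext => -[r||].
apply: measurable_fun_ifT => //; first exact: measurable_fun_eqe.
apply: measurable_fun_ifT => //; first exact: measurable_fun_eqe.
apply/measurable_EFinP; apply: (measurableT_comp (@measurable_expR R)).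
exact: fine_measurable.
Qed.

Lemma mulrn_EFin (R : realType) (x : \bar R) n : x *+ n = (n%:R%:E * x)%E.
Proof.
elim: n => [|n IH]; first by rewrite mulr0n mul0e.
by rewrite mulrSr IH -natr1 EFinD ge0_muleDl ?mul1e// lee_fin.
Qed.

(** * Averaging the beta weight over rotations *)

Section beta_mixture.
Context (R : realType) (N p M : nat) (V : R -> \bar R).
Hypothesis hM : ((N - 1) * p + 1 <= M)%N.
Hypothesis mV : measurable_fun (`[0%R, +oo[%classic : set R) V.
Local Notation mu := (@lebesgue_measure R).
Local Open Scope ereal_scope.

(** The integrand of Gamma_V at parameter 1 + k; the natural power agrees with the real one for x >=
    0. *)
Definition gamma_weight (k : nat) (x : R) : \bar R :=
  (x ^+ k)%:E * expeR (- V x).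

Lemma gamma_weight_ge0 k x : (0 <= x)%R -> 0 <= gamma_weight k x.
Proof. by move=> x0; rewrite mule_ge0 ?expeR_ge0// lee_fin exprn_ge0. Qed.

Lemma measurable_gamma_weight k :
  measurable_fun (`[0%R, +oo[%classic : set R) (gamma_weight k).
Proof.
apply: emeasurable_funM.
  by apply/measurable_EFinP; apply: measurable_funTS; exact: measurable_funX.
apply: (measurableT_comp (@measurable_expeR R)).
exact: (measurableT_comp (@oppe_measurable R setT) mV).
Qed.

Lemma gammaV_weight (k : nat) :
  gammaV V (1 + (k : int)%:~R) = \int[mu]_(x in `[0%R, +oo[) gamma_weight k x.
Proof.
apply: eq_integral => x; rewrite inE /= in_itv/= andbT => x0.
by rewrite /gamma_weight [(1 + _)%R]addrC addrK powR_mulrn.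
Qed.

Let M0 : (0 < M)%N. Proof. by apply: leq_trans hM; rewrite addn1. Qed.

Let vdm (z : N.-tuple R[i]) : R[i] :=
  ((\prod_(i < N) \prod_(j < N | (i < j)%N) (tnth z j - tnth z i)) ^+ p)%R.

Let pot (z : N.-tuple R[i]) : \bar R :=
  \prod_(i < N) expeR (- V (sqnorm (tnth z i))).

(** Since beta is the even integer 2 p, the interaction is the squared modulus of a polynomial,
    which can be expanded. *)
Lemma beta_weightE z :
  beta_weight (2 * p)%:R V z = (sqnorm (vdm z))%:E * pot z.
Proof.
rewrite /beta_weight /pot; congr (_ * _); last first.
  by apply: eq_bigr => i _; rewrite normc_sqnorm.
congr EFin; rewrite /vdm sqnormX (big_morph _ (@sqnormM R) (@sqnorm1 R)) -prodrXl.
apply: eq_bigr => i _; rewrite (big_morph _ (@sqnormM R) (@sqnorm1 R)) -prodrXl.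
apply: eq_bigr => j _.
have n0 (x : R[i]) : (0 <= Normc.normc x)%R.
  by case: x => a b; rewrite sqrtr_ge0.
rewrite powR_mulrn// exprM normc_sqnorm; congr (_ ^+ _)%R.
by case: (tnth z i) (tnth z j) => [a b] [c e]; rewrite /sqnorm /=; ring.
Qed.

Let index := {ffun 'I_N -> 'I_M}.

Definition mixture_coef (e : index) : R :=
  ((vandermonde_coef p (latent_index e))%:~R)%R.

Definition polar_density (e : index) (t : N.-tuple (R * R)) : \bar R :=
  \prod_(i < N) polar_weight (gamma_weight (e i)) (tnth t i).

Definition polar_points (t : N.-tuple (R * R)) : N.-tuple R[i] :=
  [tuple polar_power M (tnth t i) | i < N].

Lemma polar_density_ge0 e t : 0 <= polar_density e t.
Proof.
by apply: prode_ge0 => i _; apply: polar_weight_ge0; exact: gamma_weight_ge0.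
Qed.

Lemma measurable_polar_density e : measurable_fun setT (polar_density e).
Proof.
apply: (measurable_prod_tnth (f := fun i => polar_weight (gamma_weight (e i)))).
move=> i; apply: measurable_polar_weight.
exact: measurable_gamma_weight.
Qed.

Lemma measurable_polar_points : measurable_fun setT polar_points.
Proof.
apply: (measurable_mktuple (f := fun=> polar_power M)) => i.
exact: measurable_polar_power.
Qed.

Let mpot : measurable_fun setT pot.
Proof.
(* [V] is measurable on the half-line only; this extension by 0 is measurable everywhere and agrees
   at squared moduli. *)
pose w := gamma_weight 0 \_ `[0%R, +oo[%classic.
rewrite (_ : pot = fun z => \prod_(i < N) w (sqnorm (tnth z i))).
  apply: (measurable_prod_tnth (f := fun=> w \o @sqnorm R)) => _.
  apply: measurableT_comp; last exact: measurable_sqnorm.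
  apply/(measurable_restrictT _ _).1 => //; exact: measurable_gamma_weight.
apply/funext => z; apply: eq_bigr => i _; rewrite /w patchE ifT.
  by rewrite /gamma_weight expr0 mul1e.
by rewrite inE /= in_itv/= sqnorm_ge0.
Qed.

Let pot_ge0 z : 0 <= pot z.
Proof. by apply: prode_ge0 => i _; exact: expeR_ge0. Qed.

Let mvdm : measurable_fun setT vdm.
Proof.
apply: measurable_complexX.
apply: measurable_complex_prod => i; apply: measurable_complex_prod => j.
by apply: measurable_complexB; exact: measurable_tnth.
Qed.

Lemma measurable_beta_weight : measurable_fun setT (beta_weight (N := N) (2 * p)%:R V).
Proof.
rewrite (_ : beta_weight _ _ = fun z => (sqnorm (vdm z))%:E * pot z).
  apply: emeasurable_funM => //; apply/measurable_EFinP.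
  exact: (measurableT_comp (@measurable_sqnorm R)).
by apply/funext => z; rewrite beta_weightE.
Qed.

Let rot (k : index) (i : 'I_N) (z : R[i]) : R[i] :=
  (cis ((k i)%:R * (2 * pi / M%:R)) * z)%R.

Let rots k (z : N.-tuple R[i]) := [tuple rot k i (tnth z i) | i < N].

Let mrot k i : measurable_fun setT (rot k i).
Proof. by apply: measurable_complexM. Qed.

Let rot_power k i z : (rot k i z ^+ M = z ^+ M)%R.
Proof.
rewrite /rot exprMn cisX mulrCA [(M%:R * _)%R]mulrC divfK ?pnatr_eq0 -?lt0n//.
by rewrite -cisX /cis mulr_natl cos2pi sin2pi expr1n mul1r.
Qed.

Let tuple_integral_rots k (H : N.-tuple R[i] -> \bar R) :
  measurable_fun setT H -> (forall z, 0 <= H z) ->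
  \int[tuple_sfm (complex_sfm R) N]_z H (rots k z) =
  \int[tuple_sfm (complex_sfm R) N]_z H z.
Proof.
move=> mH H0.
have key := @tuple_integral_transport _ _ _ _ _ _ _ (complex_sfm R)
  (complex_sfm R) N (rot k) (fun=> id) (fun=> cst 1) (fun=> cst 1)
  (mrot k) (fun=> @measurable_id _ _ setT) (fun=> measurable_cst 1)
  (fun=> measurable_cst 1) (fun _ _ => lee01) (fun _ _ => lee01) _ H mH H0.
rewrite !tuple_sfmE in key.
have idE (z : N.-tuple R[i]) : [tuple tnth z i | i < N] = z.
  by apply: eq_from_tnth => i; rewrite tnth_mktuple.
transitivity (\int[tuple_sfm (complex_sfm R) N]_z
    (H (rots k z) * \prod_(i < N) cst 1 (tnth z i))).
  by apply: eq_integral => z _; rewrite big1 ?mule1.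
rewrite key => [|i g mg g0].
  by apply: eq_integral => z _; rewrite big1 ?mule1 ?idE.
under eq_integral do rewrite mule1; under [RHS]eq_integral do rewrite mule1.
by rewrite complex_integral_rotation// sqnorm_cis.
Qed.

(** Under the integral, [parseval] turns the average over rotations into a sum over single
    exponents. Each summand is a product over the coordinates, to which the one-variable polar
    formula applies. *)
Lemma beta_integral_power (G : N.-tuple R[i] -> \bar R) :
  measurable_fun setT G -> (forall z, 0 <= G z) ->
  \int[tuple_sfm (complex_sfm R) N]_z
    (G [tuple (tnth z i ^+ M)%R | i < N] * beta_weight (2 * p)%:R V z) =
  \sum_(e : index) (mixture_coef e ^+ 2)%:E *
    \int[tuple_sfm (plane_sfm R) N]_t
      (G (polar_points t) * polar_density e t).
Proof.
move=> mG G0.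
pose pw (z : N.-tuple R[i]) := [tuple (tnth z i ^+ M)%R | i < N].
have mpw : measurable_fun setT pw.
  apply: (measurable_mktuple (f := fun _ (x : R[i]) => (x ^+ M)%R)) => i.
  exact: measurable_complexX.
pose H z := G (pw z) * ((sqnorm (vdm z))%:E * pot z).
have mH : measurable_fun setT H.
  apply: emeasurable_funM; first exact: measurableT_comp.
  apply: emeasurable_funM => //; apply/measurable_EFinP.
  exact: (measurableT_comp (@measurable_sqnorm R)).
have H0 z : 0 <= H z by rewrite mule_ge0// mule_ge0// lee_fin sqnorm_ge0.
pose w (e : index) (z : N.-tuple R[i]) :=
  \prod_(i < N) gamma_weight (e i) (sqnorm (tnth z i)).
have mga (e : index) i : measurable_fun setT
    (fun z : R[i] => gamma_weight (e i) (sqnorm z)).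
  pose g := gamma_weight (e i) \_ `[0%R, +oo[%classic.
  rewrite (_ : (fun _ => _) = g \o @sqnorm R).
    apply: measurableT_comp; last exact: measurable_sqnorm.
    apply/(measurable_restrictT _ _).1 => //; exact: measurable_gamma_weight.
  apply/funext => z; rewrite /g /= patchE ifT//.
  by rewrite inE /= in_itv/= sqnorm_ge0.
have ga0 (e : index) i (z : R[i]) : 0 <= gamma_weight (e i) (sqnorm z).
  exact/gamma_weight_ge0/sqnorm_ge0.
have mw e : measurable_fun setT (w e) by exact: (measurable_prod_tnth (mga e)).
have w0 e z : 0 <= w e z by exact: prode_ge0.
pose E (z : N.-tuple R[i]) :=
  \sum_(e : index) (mixture_coef e ^+ 2)%:E * (G (pw z) * w e z).
have M1 : (0 < M%:R ^+ N :> R)%R by rewrite exprn_gt0// ltr0n.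
have Gw0 e z : 0 <= G (pw z) * w e z by rewrite mule_ge0.
have mGw e : measurable_fun setT (fun z => G (pw z) * w e z).
  by apply: emeasurable_funM => //; exact: measurableT_comp.
have c0 e : 0 <= (mixture_coef e ^+ 2)%:E by rewrite lee_fin sqr_ge0.
(* The left side is the sum of the integrals of the M^N rotated copies of [H]; only the Vandermonde
   factor differs between copies. *)
have step : (M%:R ^+ N)%:E * \int[tuple_sfm (complex_sfm R) N]_z H z =
    (M%:R ^+ N)%:E * \int[tuple_sfm (complex_sfm R) N]_z E z.
  transitivity (\sum_(k : index)
      \int[tuple_sfm (complex_sfm R) N]_z H (rots k z)).
    rewrite (eq_bigr (fun=> \int[tuple_sfm (complex_sfm R) N]_z H z)).
      by rewrite sumr_const card_ffun !card_ord mulrn_EFin natrX.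
    by move=> k _; exact: tuple_integral_rots.
  have mHr k : measurable_fun setT (H \o rots k).
    by apply: measurableT_comp => //; exact: (measurable_mktuple (mrot k)).
  rewrite -ge0_integral_sum//.
  rewrite -ge0_integralZl//; last 2 first.
  - by apply: emeasurable_sum => e; exact: emeasurable_funM.
  - by move=> z _; apply: sume_ge0 => e _; rewrite mule_ge0.
  apply: eq_integral => z _.
  pose D (k : index) := sqnorm (vdm (rots k z)).
  have HE k : H (rots k z) = (D k)%:E * (G (pw z) * pot z).
    have -> : H (rots k z) = G (pw z) * ((D k)%:E * pot z).
      congr (G _ * (_ * _)).
        by apply: eq_from_tnth => i; rewrite !tnth_mktuple rot_power.
      apply: eq_bigr => i _; rewrite tnth_mktuple sqnormM sqnorm_cis mul1r//.
    by rewrite muleCA.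
  under eq_bigr do rewrite /= HE.
  rewrite -ge0_sume_distrl; last by move=> k _; rewrite lee_fin sqnorm_ge0.
  rewrite sumEFin.
  have -> : (\sum_k D k)%R = (M%:R ^+ N * \sum_(e : index)
      (mixture_coef e ^+ 2 * \prod_(i < N) sqnorm (tnth z i) ^+ e i))%R.
    rewrite -(parseval M0 mixture_coef (tnth z)); apply: eq_bigr => k _.
    rewrite /D /vdm; congr sqnorm.
    transitivity ((\prod_(i < N) \prod_(j < N | (i < j)%N)
        (rot k j (tnth z j) - rot k i (tnth z i))) ^+ p)%R.
      congr (_ ^+ _)%R; apply: eq_bigr => i _; apply: eq_bigr => j _.
      by rewrite !tnth_mktuple.
    rewrite (vandermonde_expansion hM (fun i => rot k i (tnth z i))).
    apply: eq_bigr => e _; congr (_ * _)%R.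
    by rewrite /mixture_coef -(rmorph_int (real_complex R)).
  rewrite EFinM -muleA; congr (_ * _).
  rewrite -sumEFin ge0_sume_distrl; last first.
    move=> e _; rewrite lee_fin mulr_ge0 ?sqr_ge0// prodr_ge0// => i _.
    by rewrite exprn_ge0// sqnorm_ge0.
  apply: eq_bigr => e _; rewrite EFinM -muleA; congr (_ * _).
  rewrite muleCA; congr (_ * _); rewrite -prodEFin /pot -big_split /=.
  by apply: eq_bigr => i _.
have -> : \int[tuple_sfm (complex_sfm R) N]_z
    (G (pw z) * beta_weight (2 * p)%:R V z) =
    \int[tuple_sfm (complex_sfm R) N]_z E z.
  transitivity (\int[tuple_sfm (complex_sfm R) N]_z H z).
    by apply: eq_integral => z _; rewrite beta_weightE.
  move/(congr1 (mule ((M%:R ^+ N)^-1)%:E)): step.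
  by rewrite !muleA -!EFinM !mulVf ?gt_eqF// !mul1e.
rewrite ge0_integral_sum//; last 2 first.
- by move=> e; exact: emeasurable_funM.
- by move=> e z _; rewrite mule_ge0.
apply: eq_bigr => e _; rewrite ge0_integralZl//; congr (_ * _).
have := @tuple_integral_transport _ _ _ _ _ _ _ (complex_sfm R) (plane_sfm R) N
  (fun _ (x : R[i]) => (x ^+ M)%R) (fun=> polar_power M)
  (fun i z => gamma_weight (e i) (sqnorm z))
  (fun i => polar_weight (gamma_weight (e i)))
  (fun=> measurable_complexX _ (@measurable_id _ _ setT))
  (fun=> @measurable_polar_power R M) (mga e)
  (fun=> measurable_polar_weight (@measurable_gamma_weight _)) (ga0 e)
  (fun i t => polar_weight_ge0 t (@gamma_weight_ge0 (e i))).
rewrite !tuple_sfmE; apply => // i g mg g0.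
by apply: complex_integral_power => //;
  [exact: measurable_gamma_weight|exact: gamma_weight_ge0].
Qed.

End beta_mixture.

(** * The law of the powers *)

Section density_measure.
Context d (T : measurableType d) (R : realType).
Variables (mu : {measure set T -> \bar R}) (f : T -> \bar R).
Hypotheses (mf : measurable_fun setT f) (f0 : forall x, (0 <= f x)%E).
Local Open Scope ereal_scope.

Let density (A : set T) := \int[mu]_(x in A) f x.

Let density0 : density set0 = 0.
Proof. exact: integral_set0. Qed.

Let density_ge0 A : 0 <= density A.
Proof. exact: integral_ge0. Qed.

Let density_sigma_additive : semi_sigma_additive density.
Proof.
move=> F mF tF mUF; rewrite /density; apply: cvg_toP.
  apply: ereal_nondecreasing_is_cvgn => m n mn.
  by apply: lee_sum_nneg_natr => // k _ _; exact: integral_ge0.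
by rewrite ge0_integral_bigcup//; exact: measurable_funTS.
Qed.

HB.instance Definition _ := isMeasure.Build _ _ _ density
  density0 density_ge0 density_sigma_additive.

Definition density_measure : {measure set T -> \bar R} := density.

Lemma density_measureE A : density_measure A = \int[mu]_(x in A) f x.
Proof. by []. Qed.

End density_measure.

(** Positivity matters because 0 * +oo = 0: a zero factor would hide an infinite one. *)
Lemma prode_gt0_lty (R : realType) (I : finType) (h : I -> \bar R) :
  (forall i, 0 < h i)%E -> (\prod_i h i < +oo)%E -> forall i, (h i < +oo)%E.
Proof.
move=> h0 hoo i; rewrite ltey; apply/eqP => hi.
have : (0 < \prod_(j | j != i) h j)%E.
  by elim/big_ind : _ => // x y x0 y0; exact: mule_gt0.
move: hoo; rewrite (bigD1 i)//= hi => /[swap] p0.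
by rewrite gt0_mulye.
Qed.

(** * The polar measure on rectangles *)

Section uniform_angle.
Context (R : realType).
Local Notation mu := (@lebesgue_measure R).
Local Open Scope ereal_scope.

Lemma uniform_probE (A : set R) : measurable A ->
  uniform_prob (two_pi_gt0 R) A =
  ((2 * pi)^-1)%:E * \int[mu]_(t in A) (\1_(`[0%R, (2 * pi)%R]%classic : set R) t)%:E.
Proof.
move=> mA; rewrite /uniform_prob -ge0_integralZl//; last 2 first.
- by apply/measurable_EFinP; apply: measurable_funTS; exact: measurable_indic.
- by rewrite lee_fin invr_ge0 ltW// two_pi_gt0.
apply: eq_integral => t _; rewrite /uniform_pdf indicE mem_setE in_itv/= subr0.
by rewrite -EFinM; case: ifPn => _; rewrite ?mulr1 ?mulr0.
Qed.

Lemma polar_weight_rect (w : R -> \bar R) (A B : set R) :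
  measurable_fun (`[0%R, +oo[%classic : set R) w ->
  (forall x, (0 <= x)%R -> 0 <= w x) -> measurable A -> measurable B ->
  \int[plane_sfm R]_(xt in A `*` B) polar_weight w xt =
  pi%:E * ((\int[mu]_(x in `[0%R, +oo[ `&` A) w x) *
    uniform_prob (two_pi_gt0 R) B).
Proof.
move=> mw w0 mA mB.
pose wA := (w \_ `[0%R, +oo[) \_ A.
pose cB t := (\1_(`[0%R, (2 * pi)%R]%classic : set R) t)%:E : \bar R.
have mwA : measurable_fun setT wA.
  apply/(measurable_restrictT _ _).1 => //; apply: measurable_funTS.
  exact/(measurable_restrictT _ _).1.
have wA0 x : 0 <= wA x.
  rewrite /wA patchE; case: ifPn => // _; rewrite patchE; case: ifPn => //.
  by rewrite inE /= in_itv/= andbT => /w0.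
have mcB : measurable_fun setT (cB \_ B).
  apply/(measurable_restrictT _ _).1 => //; apply: measurable_funTS.
  by apply/measurable_EFinP; exact: measurable_indic.
have cB0 t : 0 <= (cB \_ B) t by rewrite patchE; case: ifPn => //; rewrite lee_fin.
rewrite integral_mkcond.
transitivity (\int[plane_sfm R]_xt ((2^-1)%:E * (wA xt.1 * (cB \_ B) xt.2))).
  apply: eq_integral => -[x t] _; rewrite !patchE /wA !patchE /polar_weight /=.
  rewrite in_setX/= patchE.
  case: (x \in A); last by rewrite mul0e mule0.
  case: (t \in B) => /=; last by rewrite !mule0.
  by rewrite EFinM muleCA.
have mprod : measurable_fun setT
    (fun xt : measurableTypeR R * measurableTypeR R => wA xt.1 * (cB \_ B) xt.2).
  apply: emeasurable_funM.
    exact: (measurableT_comp mwA).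
  exact: (measurableT_comp mcB).
rewrite ge0_integralZl//; last by move=> xt _; rewrite mule_ge0.
rewrite fubini_tonelli1//=; last by move=> xt; rewrite mule_ge0.
have -> : \int[mu]_x \int[mu]_t (wA x * (cB \_ B) t) =
    \int[mu]_x wA x * \int[mu]_t (cB \_ B) t.
  rewrite -ge0_integralZr//; last by apply: integral_ge0.
  by apply: eq_integral => x _; rewrite -ge0_integralZl.
have -> : \int[mu]_x wA x = \int[mu]_(x in `[0%R, +oo[ `&` A) w x.
  by rewrite setIC integral_mkcondr [RHS]integral_mkcond.
have -> : \int[mu]_t (cB \_ B) t = \int[mu]_(t in B) cB t.
  by rewrite [RHS]integral_mkcond.
rewrite uniform_probE// -/cB; move: (\int[mu]_(x in _) w x) => a.
move: (\int[mu]_(t in B) cB t) => b.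
rewrite [RHS]muleCA [in RHS](muleA pi%:E) -EFinM.
rewrite (_ : pi * _ = 2^-1)%R; last first.
  by rewrite invfM mulrC -mulrA mulVf ?mulr1// gt_eqF// pi_gt0.
by rewrite muleCA.
Qed.

End uniform_angle.

(** * The components of the mixture *)

Section latent_components.
Context (R : realType) (N p M : nat) (V : R -> \bar R).
Hypothesis hM : ((N - 1) * p + 1 <= M)%N.
Hypothesis mV : measurable_fun (`[0%R, +oo[%classic : set R) V.
Hypothesis wd : beta_well_defined N (2 * p)%:R V.
Local Notation mu := (@lebesgue_measure R).
Local Notation index := {ffun 'I_N -> 'I_M}.
Local Notation unif := (uniform_prob (two_pi_gt0 R)).
Local Open Scope ereal_scope.

Let mass : R := fine (beta_mass N (2 * p)%:R V).

Let massE : beta_mass N (2 * p)%:R V = mass%:E.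
Proof. by rewrite fineK// gt0_fin_numE//; case/andP: wd. Qed.

Let mass_gt0 : (0 < mass)%R.
Proof. by rewrite -lte_fin -massE; case/andP: wd. Qed.

Let coef (e : index) : R := (mass^-1 * mixture_coef R p e ^+ 2)%R.

Let coef_ge0 e : (0 <= coef e)%R.
Proof. by rewrite mulr_ge0 ?sqr_ge0// invr_ge0 ltW. Qed.

Let dens (e : index) (t : N.-tuple (R * R)) : \bar R :=
  (coef e)%:E * polar_density V e t.

Let mdens e : measurable_fun setT (dens e).
Proof. by apply: emeasurable_funM => //; exact: measurable_polar_density. Qed.

Let dens_ge0 e t : 0 <= dens e t.
Proof. by rewrite mule_ge0 ?lee_fin// polar_density_ge0. Qed.

(** Deliberately not normalised: its total mass is the probability that I is [latent_index e], so
    these measures simply add up, even where that probability is 0. *)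
Definition component (e : index) :=
  density_measure (tuple_sfm (plane_sfm R) N) (mdens e) (dens_ge0 e).

Definition weight_integral (k : nat) (A : set R) : \bar R :=
  \int[mu]_(x in `[0%R, +oo[ `&` A) gamma_weight V k x.

Lemma weight_integral_ge0 k A : 0 <= weight_integral k A.
Proof.
apply: integral_ge0 => x [] /=; rewrite in_itv/= andbT => x0 _.
exact: gamma_weight_ge0.
Qed.

Lemma gammaV_lawE (k : nat) (A : set R) : gammaV_law V (1 + (k : int)%:~R) A =
  (fine (gammaV V (1 + (k : int)%:~R)))^-1%:E * weight_integral k A.
Proof.
congr (_ * _); apply: eq_integral => x; rewrite inE => -[] /=.
rewrite in_itv/= andbT => x0 _.
by rewrite /gamma_weight [(1 + _)%R]addrC addrK powR_mulrn.
Qed.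

Lemma gammaVE (k : nat) : gammaV V (1 + (k : int)%:~R) = weight_integral k setT.
Proof. by rewrite /weight_integral setIT gammaV_weight. Qed.

Definition rectangle (A B : 'I_N -> set R) : set (N.-tuple (R * R)) :=
  [set t | forall i, A i (tnth t i).1 /\ B i (tnth t i).2].

Lemma component_rectangle e (A B : 'I_N -> set R) :
  (forall i, measurable (A i)) -> (forall i, measurable (B i)) ->
  component e (rectangle A B) = (coef e)%:E *
    \prod_(i < N) (pi%:E * (weight_integral (e i) (A i) * unif (B i))).
Proof.
move=> mA mB.
pose f i := polar_weight (gamma_weight V (e i)) \_ (A i `*` B i).
have mAB i : measurable (A i `*` B i) by exact: measurableX.
have mf i : measurable_fun setT (f i).
  apply/(measurable_restrictT _ _).1 => //; apply: measurable_funTS.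
  by apply: measurable_polar_weight; exact: measurable_gamma_weight.
have f0 i xt : 0 <= f i xt.
  rewrite /f patchE; case: ifPn => // _.
  by apply: polar_weight_ge0; exact: gamma_weight_ge0.
transitivity (\int[tuple_sfm (plane_sfm R) N]_t
    ((coef e)%:E * \prod_(i < N) f i (tnth t i))).
  rewrite density_measureE integral_mkcond.
  apply: eq_integral => t _; rewrite patchE /dens.
  have [/[!inE] tAB|tAB] := boolP (t \in rectangle A B).
    congr (_ * _); apply: eq_bigr => i _; rewrite /f patchE ifT// inE.
    exact: tAB.
  have [i /negP ti] : exists i, ~~ (tnth t i \in A i `*` B i).
    apply/existsP; apply: contraR tAB; rewrite negb_exists => /forallP h.
    by rewrite inE => i; have := h i; rewrite negbK inE.
  rewrite (bigD1 i)//= /f patchE ifF ?mul0e ?mule0//.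
  exact/negbTE/negP.
rewrite ge0_integralZl//; last 3 first.
- exact: measurable_prod_tnth.
- by move=> t _; exact: prode_ge0.
- by rewrite lee_fin.
have := tuple_integral_prod (plane_sfm R) mf f0; rewrite tuple_sfmE => ->.
apply: (congr1 (mule _)); apply: eq_bigr => i _; rewrite /f -integral_mkcond polar_weight_rect//.
- exact: measurable_gamma_weight.
- by move=> x; exact: gamma_weight_ge0.
Qed.

(** Each coordinate contributes a factor pi, and their product turns the inverse of the total mass
    into the inverse of [beta_Z]. *)
Lemma component_setT e : component e setT = latent_pmf p V (latent_index e).
Proof.
rewrite (_ : setT = rectangle (fun=> setT) (fun=> setT)); last first.
  by apply/seteqP; split => // t _ i.
rewrite component_rectangle// /latent_pmf.
have u1 : unif setT = 1 by rewrite probability_setT.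
under eq_bigr do rewrite u1 mule1 -gammaVE.
rewrite big_split /= prodEFin prodr_const card_ord muleA -EFinM.
apply: congr2.
  congr EFin; rewrite /coef /beta_Z -/mass invf_div -/(mixture_coef R p e).
  by ring.
by apply: eq_bigr => i _; rewrite ffunE.
Qed.

Lemma beta_ensemble_power (A : set (N.-tuple R[i])) : measurable A ->
  beta_ensemble (2 * p)%:R V
    [set z | A [tuple (tnth z i ^+ M)%R | i < N]] =
  \sum_(e : index) component e (@polar_points R N M @^-1` A).
Proof.
move=> mA.
pose G (z : N.-tuple R[i]) : \bar R := (\1_A z)%:E.
have mG : measurable_fun setT G by apply/measurable_EFinP; exact: measurable_indic.
have G0 z : 0 <= G z by rewrite lee_fin.
have GE := beta_integral_power hM mV mG G0.
have mbw := @measurable_beta_weight R N p V mV.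
pose S : set (N.-tuple R[i]) := [set z | A [tuple (tnth z i ^+ M)%R | i < N]].
rewrite /beta_ensemble.
have -> : (pi ^+ N * beta_Z N (2 * p)%:R V)^-1%R = mass^-1%R.
  by rewrite /beta_Z -/mass mulrC divfK// expf_eq0 gt_eqF ?andbF// pi_gt0.
have -> : \int[@tuple_measure _ _ _ (@complex_lebesgue R) N]_(z in S)
      beta_weight (2 * p)%:R V z =
    \int[tuple_sfm (complex_sfm R) N]_z
      (G [tuple (tnth z i ^+ M)%R | i < N] * beta_weight (2 * p)%:R V z).
  have -> : @tuple_measure _ _ _ (@complex_lebesgue R) N =
    tuple_sfm (complex_sfm R) N := tuple_sfmE (complex_sfm R) N.
  rewrite integral_mkcond.
  congr integral; apply/funext => z; rewrite patchE /G indicE.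
  have -> : (z \in S) = ([tuple (tnth z i ^+ M)%R | i < N] \in A).
    by apply/idP/idP; rewrite !inE.
  by case: (_ \in _); rewrite ?mul1e ?mul0e.
rewrite GE ge0_sume_distrr; last first.
  move=> e _; rewrite mule_ge0 ?lee_fin ?sqr_ge0//; apply: integral_ge0 => t _.
  by rewrite mule_ge0// polar_density_ge0.
apply: eq_bigr => e _; rewrite density_measureE integral_mkcond muleA -EFinM.
rewrite -ge0_integralZl//; last 3 first.
- apply: emeasurable_funM; last exact: measurable_polar_density.
  exact: (measurableT_comp mG (@measurable_polar_points R N M)).
- by move=> t _; rewrite mule_ge0// polar_density_ge0.
- by rewrite lee_fin coef_ge0.
apply: eq_integral => t _; rewrite patchE /G indicE /dens.
have -> : (t \in polar_points M @^-1` A) = (polar_points M t \in A).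
  by apply/idP/idP; rewrite !inE.
by case: (_ \in _); rewrite ?mul1e ?mul0e ?mule0.
Qed.

(** This is the mixture formula on the whole space, where the beta ensemble has mass 1. *)
Lemma sum_latent_pmf : \sum_(e : index) latent_pmf p V (latent_index e) = 1.
Proof.
under eq_bigr do rewrite -component_setT.
transitivity (\sum_(e : index) component e (@polar_points R N M @^-1` setT)) => //.
rewrite -beta_ensemble_power//.
rewrite (_ : [set z | setT _] = setT); last by apply/seteqP; split.
rewrite /beta_ensemble -/(beta_mass _ _ _) massE -EFinM; congr EFin.
rewrite /beta_Z -/mass [(pi ^+ N * _)%R]mulrC divfK ?mulVf ?gt_eqF//.
by rewrite exprn_gt0// pi_gt0.
Qed.

(** A nonzero weight is at most 1 and is a product of positive factors, so each factor is finite.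
    Hence [gammaV_law] is a probability for every value of I on which one conditions. *)
Lemma weight_integral_gt0_lty (e : index) i : latent_pmf p V (latent_index e) != 0 ->
  0 < weight_integral (e i) setT < +oo.
Proof.
move=> pmf0; move: i; pose g i := weight_integral (e i) setT.
have pmf_le1 : latent_pmf p V (latent_index e) <= 1.
  rewrite -sum_latent_pmf (bigD1 e)//= leeDl// sume_ge0// => f _.
  by rewrite -component_setT.
have pmfE : latent_pmf p V (latent_index e) = (coef e)%:E * \prod_(i < N) (pi%:E * g i).
  rewrite -component_setT.
  rewrite (_ : setT = rectangle (fun=> setT) (fun=> setT)); last first.
    by apply/seteqP; split => // t _ i.
  rewrite component_rectangle//; congr (_ * _); apply: eq_bigr => i _.
  by rewrite probability_setT mule1.
have g_ge0 i : 0 <= g i by exact: weight_integral_ge0.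
have pig_gt0 i : 0 < pi%:E * g i.
  rewrite lt_neqAle mule_ge0 ?lee_fin ?pi_ge0// andbT eq_sym.
  apply: contra_neq pmf0 => gi; rewrite pmfE (bigD1 i)//= gi mul0e mule0//.
have coef_gt0 : 0 < (coef e)%:E.
  rewrite lt_neqAle lee_fin coef_ge0 andbT eq_sym.
  by apply: contra_neq pmf0 => c; rewrite pmfE c mul0e.
move=> i; apply/andP; split.
  rewrite lt_neqAle g_ge0 andbT; apply/eqP => gi; have := pig_gt0 i.
  by rewrite /g -gi mule0 ltxx.
have : pi%:E * g i < +oo.
  apply: (prode_gt0_lty pig_gt0); rewrite ltey; apply: contraTneq pmf_le1 => P.
  by rewrite pmfE P gt0_muley// -ltNge ltry.
rewrite !ltey; apply: contra_neq => gi; rewrite -/(g i) in gi.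
by rewrite gi gt0_muley// lte_fin pi_gt0.
Qed.

Lemma gammaV_law_setT (e : index) i : latent_pmf p V (latent_index e) != 0 ->
  gammaV_law V (1 + (latent_index e i)%:~R) setT = 1.
Proof.
move=> /(weight_integral_gt0_lty i)/andP[g0 goo]; rewrite ffunE gammaV_lawE gammaVE.
have gfin : weight_integral (e i) setT \is a fin_num by rewrite ge0_fin_numE ?ltW.
rewrite -[X in _ * X](fineK gfin) -EFinM mulVf// gt_eqF//.
by rewrite fine_gt0// g0.
Qed.

Lemma component_rectangle_prod (e : index) (A B : 'I_N -> set R) :
  latent_pmf p V (latent_index e) != 0 ->
  (forall i, measurable (A i)) -> (forall i, measurable (B i)) ->
  component e (rectangle A B) = latent_pmf p V (latent_index e) *
   ((\prod_(i < N) unif (B i)) *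
    \prod_(i < N) gammaV_law V (1 + (latent_index e i)%:~R) (A i)).
Proof.
move=> pmf0 mA mB; rewrite component_rectangle// -component_setT.
rewrite (_ : setT = rectangle (fun=> setT) (fun=> setT)); last first.
  by apply/seteqP; split => // t _ i.
rewrite component_rectangle// -muleA; congr (_ * _).
rewrite -!big_split /=; apply: eq_bigr => i _.
have /andP[g0 goo] := weight_integral_gt0_lty i pmf0.
have gfin : weight_integral (e i) setT \is a fin_num by rewrite ge0_fin_numE ?ltW.
rewrite ffunE gammaV_lawE gammaVE probability_setT mule1 -muleA; congr (_ * _).
rewrite -{1}(fineK gfin) (muleCA (unif (B i))) [RHS]muleA -EFinM mulfV ?mul1e.
  by rewrite muleC.
by rewrite gt_eqF// fine_gt0// g0.
Qed.

End latent_components.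

(** * Latent samples *)

Section rectangle_generate.
Context (R : realType) (N : nat).
Local Notation Pl := (measurableTypeR R * measurableTypeR R)%type.

Definition rectangles : set (set (N.-tuple Pl)) :=
  [set rectangle A B | A in [set A | forall i, measurable (A i)] &
                       B in [set B | forall i, measurable (B i)]].

Lemma measurable_rectangle (A B : 'I_N -> set R) :
  (forall i, measurable (A i)) -> (forall i, measurable (B i)) ->
  measurable (rectangle A B : set (N.-tuple Pl)).
Proof.
move=> mA mB; rewrite (_ : rectangle A B =
    \bigcap_(i in [set: 'I_N]) ((fun t : N.-tuple Pl => tnth t i) @^-1` (A i `*` B i))).
  apply: fin_bigcap_measurable => // i _; rewrite -[X in measurable X]setTI.
  apply: measurable_tnth => //.
  exact: (@measurableX _ _ (measurableTypeR R) (measurableTypeR R) _ _ (mA i) (mB i)).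
by apply/seteqP; split => [t tAB i _|t tAB i]; exact: tAB.
Qed.

Lemma rectangles_setI : setI_closed rectangles.
Proof.
move=> _ _ [A /= mA [B /= mB <-]] [A' /= mA' [B' /= mB' <-]].
exists (fun i => A i `&` A' i) => /=; first by move=> i; exact: measurableI.
exists (fun i => B i `&` B' i) => /=; first by move=> i; exact: measurableI.
apply/seteqP; split => [t tAB|t [tAB tAB'] i].
  by split => i; have [[? ?] [? ?]] := tAB i.
by have [? ?] := tAB i; have [? ?] := tAB' i.
Qed.

Lemma rectangles_setT : rectangles setT.
Proof.
exists (fun=> setT) => //; exists (fun=> setT) => //.
by apply/seteqP; split => // t _ i.
Qed.

(* The identity from the sigma-algebra generated by the rectangles is
   measurable because each of its real coordinates is. *)
Lemma rectangles_generate :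
  (measurable : set (set (N.-tuple Pl))) = <<s rectangles >>.
Proof.
apply/seteqP; split; last first.
  apply: smallest_sub; first exact: sigma_algebra_measurable.
  by move=> _ [A mA [B mB <-]]; exact: measurable_rectangle.
pose T := g_sigma_algebraType rectangles.
suff mid : measurable_fun (setT : set T) (fun t : T => t : N.-tuple Pl).
  by move=> A mA; have := mid measurableT A mA; rewrite setTI.
apply/measurable_fun_tnthP => i; apply/measurable_fun_pairP; split => _ A mA;
  rewrite setTI; apply: sub_sigma_algebra.
- exists (fun j => if j == i then A else setT) => /=; first by move=> j; case: ifP.
  exists (fun=> setT) => //; apply/seteqP; split => [t /(_ i)|t At j] /=.
    by rewrite eqxx => -[].
  by case: eqP => [->|].
- exists (fun=> setT) => //=.
  exists (fun j => if j == i then A else setT) => /=; first by move=> j; case: ifP.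
  apply/seteqP; split => [t /(_ i)|t At j] /=.
    by rewrite eqxx => -[].
  by case: eqP => [->|].
Qed.

End rectangle_generate.

Section image_restr.
Context d1 d2 (T1 : measurableType d1) (T2 : measurableType d2) (R : realType).
Variables (f : T1 -> T2) (E : set T1).
Hypotheses (mf : measurable_fun [set: T1] f) (mE : measurable E).
Variable mu : {measure set T1 -> \bar R}.
Local Open Scope ereal_scope.

(** Serves both for the joint law of a sample on an event I = u and, with [E] full, for tagged
    copies of the components. *)
Let map A := mu (f @^-1` A `&` E).

Let map0 : map set0 = 0.
Proof. by rewrite /map preimage_set0 set0I measure0. Qed.

Let map_ge0 A : 0 <= map A. Proof. exact: measure_ge0. Qed.

Let map_sigma_additive : semi_sigma_additive map.
Proof.
have mpre A : measurable A -> measurable (f @^-1` A `&` E).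
  by move=> mA; apply: measurableI => //; rewrite -[X in measurable X]setTI; exact: mf.
move=> F mF tF mUF; rewrite /map preimage_bigcup setI_bigcupl.
apply: measure_semi_sigma_additive.
- by move=> n; exact: mpre.
- apply/trivIsetP => /= i j _ _ ij; rewrite setIACA setIid -preimage_setI.
  by move/trivIsetP : tF => /(_ _ _ _ _ ij) ->//; rewrite preimage_set0 set0I.
- by rewrite -setI_bigcupl -preimage_bigcup; exact: mpre.
Qed.

HB.instance Definition _ := isMeasure.Build _ _ _ map
  map0 map_ge0 map_sigma_additive.

Definition image_restr : {measure set T2 -> \bar R} := map.

Lemma image_restrE A : image_restr A = mu (f @^-1` A `&` E).
Proof. by []. Qed.

End image_restr.

(** The events may leave out a null set, such as the values of I outside the range of
    [latent_index]; the part of [S] that they miss lies in it. *)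
Lemma probability_partition d (T : measurableType d) (R : realType)
    (P : probability T R) (I : finType) (E : I -> set T) (S : set T) :
  (forall i, measurable (E i)) -> trivIset setT E ->
  (\sum_i P (E i) = 1)%E -> measurable S ->
  (P S = \sum_i P (S `&` E i))%E.
Proof.
move=> mE tE E1 mS; pose U := \bigcup_i E i.
have mU : measurable U by exact: fin_bigcup_measurable.
(* Finite additivity is obtained by integrating the pointwise identity between indicators. *)
have sumU (A : set T) : measurable A -> (\sum_i P (A `&` E i) = P (A `&` U))%E.
  move=> mA; have mAE i : measurable (A `&` E i) by exact: measurableI.
  have indicE' (B : set T) : measurable B -> (P B = \int[P]_x (\1_B x)%:E)%E.
    by move=> mB; rewrite integral_indic// setIT.
  rewrite indicE'; last exact: measurableI.
  under eq_bigr do rewrite indicE'//.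
  rewrite -ge0_integral_sum//; last first.
    by move=> i; apply/measurable_EFinP; exact: measurable_indic.
  apply: eq_integral => x _; rewrite sumEFin; congr EFin.
  have [xAU|xAU] := pselect ((A `&` U) x).
    have [xA [i _ xEi]] := xAU; rewrite [RHS]indicE (mem_set xAU).
    have xAi : (A `&` E i) x by [].
    rewrite (bigD1 i)//= indicE (mem_set xAi) big1 ?addr0// => j ji.
    rewrite indicE memNset// => -[_ xEj]; move: ji => /eqP; apply.
    by apply: tE => //; exists x.
  rewrite [RHS]indicE memNset// big1// => i _; rewrite indicE memNset// => -[xA xEi].
  by apply: xAU; split => //; exists i.
have PU : P U = 1%E by rewrite -(setTI U) -sumU// -E1; apply: eq_bigr => i _; rewrite setTI.
rewrite sumU// (measureDI P mS mU) [X in (X + _)%E](_ : _ = 0%E) ?add0e//.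
apply/eqP; rewrite eq_le measure_ge0 andbT.
have <- : P (~` U) = 0%E by rewrite probability_setC// PU subee.
apply: le_measure; rewrite ?inE; [exact: measurableD|exact: measurableC|].
exact: subIsetr.
Qed.

(** * The law of an arbitrary latent sample *)

Section latent_law.
Context (R : realType) (N p M : nat) (V : R -> \bar R).
Hypothesis hM : ((N - 1) * p + 1 <= M)%N.
Hypothesis mV : measurable_fun (`[0%R, +oo[%classic : set R) V.
Hypothesis wd : beta_well_defined N (2 * p)%:R V.
Context d (T : measurableType d) (P : probability T R).
Variables (I : T -> {ffun 'I_N -> int}) (X theta : 'I_N -> {RV P >-> R}).
Hypothesis sample : latent_sample p V I X theta.
Local Notation index := {ffun 'I_N -> 'I_M}.
Local Notation Pl := (measurableTypeR R * measurableTypeR R)%type.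
Local Open Scope ereal_scope.

Let joint (w : T) : N.-tuple Pl := [tuple (X k w, theta k w) | k < N].

Let mjoint : measurable_fun setT joint.
Proof.
apply/measurable_fun_tnthP => i.
have mRV (f : {RV P >-> R}) : @measurable_fun _ _ T (measurableTypeR R) setT f.
  by move=> mT Y mY; have mf := measurable_funPT f mT Y; apply mf; exact mY.
rewrite (_ : _ \o _ = fun w => (X i w, theta i w) : Pl).
  exact: measurable_fun_pair (mRV _) (mRV _).
by apply/funext => w /=; rewrite tnth_mktuple.
Qed.

Let mI u : measurable (I @^-1` [set u]).
Proof. by case: sample. Qed.

Let pmfE u : P (I @^-1` [set u]) = latent_pmf p V u.
Proof. by case: sample => _ []. Qed.

(** Conditional independence and the marginals determine the measure on rectangles, which are stable
    under intersection and generate the sigma-algebra. *)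
Lemma latent_joint_law (e : index) (B : set (N.-tuple Pl)) : measurable B ->
  P (joint @^-1` B `&` I @^-1` [set latent_index e]) = component mV wd e B.
Proof.
move=> mB; set u := latent_index e.
pose m := image_restr mjoint (mI u) P.
(* A sample says nothing about its conditional law on a null event, but there both sides vanish by
   monotonicity. *)
have [pmf0|pmf0] := eqVneq (latent_pmf p V u) 0.
  transitivity (0%E : \bar R); last first.
    apply/esym/eqP; rewrite eq_le measure_ge0 andbT -[leRHS]pmf0 -component_setT//.
    by apply: le_measure; rewrite ?inE.
  apply/eqP; rewrite eq_le measure_ge0 andbT -[leRHS]pmf0 -pmfE.
  apply: le_measure; rewrite ?inE//.
  by apply: measurableI => //; rewrite -[X in measurable X]setTI; exact: mjoint.
have Pfin : P (I @^-1` [set u]) \is a fin_num by exact: fin_num_measure.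
have [_ [_ /(_ u)]] := sample; rewrite pmfE => /(_ pmf0)[ind unif gam].
suff : m B = component mV wd e B by [].
apply: (measure_unique (@rectangles R N) (fun=> setT)) => //.
- exact: rectangles_generate.
- exact: rectangles_setI.
- by move=> _; exact: rectangles_setT.
- by rewrite bigcup_const//; exists 0%N.
- move=> _ [A mA [C mC <-]]; rewrite [RHS]component_rectangle_prod//.
  pose Y (j : 'I_N + 'I_N) : T -> R :=
    match j with inl k => theta k : T -> R | inr k => X k end.
  pose AC (j : 'I_N + 'I_N) : set R := match j with inl k => C k | inr k => A k end.
  have mAC j : measurable (AC j) by case: j.
  have := ind AC mAC; rewrite big_sumType /=.
  under eq_bigr do rewrite unif//.
  under [X in _ = _ * X -> _]eq_bigr do rewrite gam//.
  rewrite -/u => <-.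
  have -> : \bigcap_j Y j @^-1` AC j = joint @^-1` rectangle A C.
    apply/seteqP; split => [w h k|w h [k|k] _] /=.
    - by rewrite tnth_mktuple; split; [exact: (h (inr k))|exact: (h (inl k))].
    - by have [] := h k; rewrite tnth_mktuple.
    - by have [] := h k; rewrite tnth_mktuple.
  rewrite /cond_prob -pmfE muleCA -{1}(fineK Pfin) -EFinM mulfV ?mule1//.
  by apply: contra_neq pmf0 => f0; rewrite -pmfE -(fineK Pfin) f0.
- move=> _; rewrite [X in X < _]image_restrE; apply: (@le_lt_trans _ _ 1); last exact: ltry.
  by apply: probability_le1; apply: measurableI => //; rewrite preimage_setT.
Qed.

Lemma latent_points_law (A : set (N.-tuple R[i])) : measurable A ->
  P (latent_points X theta M @^-1` A) =
  \sum_(e : index) component mV wd e (@polar_points R N M @^-1` A).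
Proof.
move=> mA.
have mB : measurable (@polar_points R N M @^-1` A : set (N.-tuple Pl)).
  by rewrite -[X in measurable X]setTI; exact: (@measurable_polar_points R N M).
have -> : latent_points X theta M @^-1` A =
    joint @^-1` (@polar_points R N M @^-1` A).
  rewrite -comp_preimage; congr (_ @^-1` A); apply/funext => w /=.
  by apply: eq_from_tnth => k; rewrite !tnth_mktuple.
rewrite (probability_partition (E := fun e : index => I @^-1` [set latent_index e])).
- by apply: eq_bigr => e _; exact: latent_joint_law.
- by move=> e; exact: mI.
- by move=> e f _ _ [w [/= -> /latent_index_inj]].
- by rewrite -(sum_latent_pmf hM mV wd); apply: eq_bigr => e _; exact: pmfE.
- by rewrite -[X in measurable X]setTI; exact: mjoint.
Qed.

End latent_law.

(** * Construction of a latent sample *)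

Section latent_existence.
Context (R : realType) (N p M : nat) (V : R -> \bar R).
Hypothesis hM : ((N - 1) * p + 1 <= M)%N.
Hypothesis mV : measurable_fun (`[0%R, +oo[%classic : set R) V.
Hypothesis wd : beta_well_defined N (2 * p)%:R V.
Local Notation index := {ffun 'I_N -> 'I_M}.
Local Notation Pl := (measurableTypeR R * measurableTypeR R)%type.
Local Notation T := (nat * N.-tuple Pl)%type.
Local Notation unif := (uniform_prob (two_pi_gt0 R)).
Local Open Scope ereal_scope.

Let M0 : (0 < M)%N. Proof. by apply: leq_trans hM; rewrite addn1. Qed.

(* The latent variable is encoded as its rank in the enumeration of [index]. *)
Let ind (k : nat) : index := nth [ffun=> Ordinal M0] (enum {: index}) k.

Let mtag (k : nat) : measurable_fun [set: N.-tuple Pl] (fun t => (k, t) : T).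
Proof. exact: pair1_measurable. Qed.

(** Each component lives on its own copy of the space of tuples, so that I can be read off the
    tag. *)
Let mixture : {measure set T -> \bar R} :=
  msum (fun k => image_restr (mtag k) measurableT (component mV wd (ind k)))
    #|{: index}|.

Let sum_ind (F : index -> \bar R) :
  \sum_(k < #|{: index}|) F (ind k) = \sum_e F e.
Proof.
rewrite [RHS](eq_bigl (fun e => e \in {: index})) //.
rewrite [RHS]big_enum_val; apply: eq_bigr => k _.
by rewrite (enum_val_nth [ffun=> Ordinal M0]).
Qed.

Let mixtureE (A : set T) :
  mixture A = \sum_(k < #|{: index}|) component mV wd (ind k) [set t | A (k : nat, t)].
Proof.
by apply: eq_bigr => k _; rewrite [LHS]image_restrE setIT.
Qed.

Let mixture_setT : mixture setT = 1.
Proof.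
rewrite mixtureE -(sum_latent_pmf hM mV wd) -sum_ind.
by apply: eq_bigr => k _; rewrite -component_setT.
Qed.

Definition latent_prob : probability T R :=
  HB.pack (mixture : set T -> \bar R) (Measure.class mixture)
    (Measure_isProbability.Build _ _ _ mixture mixture_setT).

(** Tags past the end of the enumeration give the default exponent 0; [mixture] puts no mass on
    them. *)
Definition latent_var (w : T) : {ffun 'I_N -> int} := latent_index (ind w.1).

Let mlatent_var u : measurable (latent_var @^-1` [set u]).
Proof.
rewrite (_ : _ @^-1` _ =
    (fst : T -> nat) @^-1` [set k | latent_index (ind k) = u])//.
by rewrite -[X in measurable X]setTI; exact: measurable_fst.
Qed.

Let mRV (f : T -> measurableTypeR R) : measurable_fun setT f ->
  @measurable_fun _ _ T R setT f.
Proof. by move=> mf mT Y mY; have mfY := mf mT Y; apply mfY; exact mY. Qed.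

Let mfst (k : 'I_N) :
  @measurable_fun _ _ T R setT (fun w : T => (tnth w.2 k).1).
Proof.
apply: mRV; apply: (measurableT_comp measurable_fst).
by apply: (measurableT_comp (measurable_tnth k)); exact: measurable_snd.
Qed.

Let msnd (k : 'I_N) :
  @measurable_fun _ _ T R setT (fun w : T => (tnth w.2 k).2).
Proof.
apply: mRV; apply: (measurableT_comp measurable_snd).
by apply: (measurableT_comp (measurable_tnth k)); exact: measurable_snd.
Qed.

Definition latent_radius (k : 'I_N) : {RV latent_prob >-> R} :=
  HB.pack (fun w : T => (tnth w.2 k).1) (isMeasurableFun.Build _ _ _ _ _ (mfst k)).

Definition latent_angle (k : 'I_N) : {RV latent_prob >-> R} :=
  HB.pack (fun w : T => (tnth w.2 k).2) (isMeasurableFun.Build _ _ _ _ _ (msnd k)).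

(** The sum has at most one term; in this form it also covers values [u] outside the range of
    [latent_index], where it is empty. *)
Let latent_prob_snd (u : {ffun 'I_N -> int}) (B : set (N.-tuple Pl)) :
  latent_prob (snd @^-1` B `&` latent_var @^-1` [set u]) =
  \sum_(e : index | latent_index e == u) component mV wd e B.
Proof.
rewrite [LHS]mixtureE [RHS]big_mkcond -sum_ind; apply: eq_bigr => k _.
rewrite /latent_var; case: eqP => [<-|ku].
  congr (component mV wd _ _); apply/seteqP; split => t; first by case.
  by split.
rewrite (_ : [set t | _] = set0) ?measure0//.
by rewrite -subset0 => t [_ /=].
Qed.

Let latent_prob_component (e : index) (B : set (N.-tuple Pl)) :
  latent_prob (snd @^-1` B `&` latent_var @^-1` [set latent_index e]) =
  component mV wd e B.
Proof.
rewrite latent_prob_snd (big_pred1 e)// => f.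
by rewrite (inj_eq (@latent_index_inj N M)).
Qed.

Let latent_prob_var u : latent_prob (latent_var @^-1` [set u]) = latent_pmf p V u.
Proof.
rewrite -(setTI (_ @^-1` _)) -[setT](preimage_setT (@snd nat (N.-tuple Pl))).
have [/codomP[e ->]|ucod] := boolP (u \in codom (@latent_index N M)).
  by rewrite latent_prob_component component_setT.
rewrite latent_prob_snd big_pred0; last first.
  by move=> e; apply: contraNF ucod => /eqP <-; exact: codom_f.
by rewrite /latent_pmf (vandermonde_coef_eq0 hM)// expr0n mulr0 mul0e.
Qed.

Lemma latent_sample_exists :
  latent_sample p V latent_var latent_radius latent_angle.
Proof.
split=> [u|]; last split => [|u]; first last.
- move=> pmf0 Q; have := pmf0; rewrite latent_prob_var => pmf1.
  have [e ue] : exists e : index, u = latent_index e.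
    apply/codomP; apply: contraR pmf1 => ucod.
    by rewrite /latent_pmf (vandermonde_coef_eq0 hM)// expr0n mulr0 mul0e.
  rewrite {u}ue in Q pmf0 pmf1 *.
  have pfin : latent_pmf p V (latent_index e) \is a fin_num.
    by rewrite -latent_prob_var; apply: fin_num_measure; exact: mlatent_var.
  have fpmf : fine (latent_pmf p V (latent_index e)) != 0%R.
    by apply: contra_neq pmf1 => f0; rewrite -(fineK pfin) f0.
  (* Marginals and independence are all read off this formula: a marginal event is a rectangle whose
     other sides are full and have probability 1. *)
  have Qrect (A B : 'I_N -> set R) :
      (forall i, measurable (A i)) -> (forall i, measurable (B i)) ->
      Q (snd @^-1` rectangle A B) = (\prod_(i < N) unif (B i)) *
        \prod_(i < N) gammaV_law V (1 + (latent_index e i)%:~R) (A i).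
    move=> mA mB; rewrite /Q /cond_prob latent_prob_component latent_prob_var.
    rewrite component_rectangle_prod// muleC muleA -{2}(fineK pfin) -EFinM.
    by rewrite mulVf// mul1e.
  have unifT : unif setT = 1 by rewrite probability_setT.
  have gamT i := gammaV_law_setT hM mV wd i pmf1.
  have Qangle k (A : set R) : measurable A ->
      Q (latent_angle k @^-1` A) = unif A.
    move=> mA; pose B i := if i == k then A else setT.
    have -> : latent_angle k @^-1` A = snd @^-1` rectangle (fun=> setT) B.
      apply/seteqP; split => [w wA i|w /(_ k)]; last by rewrite /B eqxx => -[].
      by split => //; rewrite /B; case: eqP => [->|].
    rewrite Qrect//; last by move=> i; rewrite /B; case: ifP.
    rewrite [X in _ * X]big1 ?mule1// (bigD1 k)//= /B eqxx big1 ?mule1// => i ik.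
    by rewrite (negbTE ik).
  have Qradius k (A : set R) : measurable A ->
      Q (latent_radius k @^-1` A) = gammaV_law V (1 + (latent_index e k)%:~R) A.
    move=> mA; pose B i := if i == k then A else setT.
    have -> : latent_radius k @^-1` A = snd @^-1` rectangle B (fun=> setT).
      apply/seteqP; split => [w wA i|w /(_ k)]; last by rewrite /B eqxx => -[].
      by split => //; rewrite /B; case: eqP => [->|].
    rewrite Qrect//; last by move=> i; rewrite /B; case: ifP.
    rewrite big1 ?mul1e// (bigD1 k)//= /B eqxx big1 ?mule1// => i ik.
    by rewrite (negbTE ik).
  split => // A mA; rewrite big_sumType /=.
  under eq_bigr do rewrite Qangle//.
  under [X in _ = _ * X]eq_bigr do rewrite Qradius//.
  rewrite -Qrect//; congr Q; apply/seteqP; split => [w h k|w h [k|k] _].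
  + by split; [exact: (h (inr k))|exact: (h (inl k))].
  + by have [] := h k.
  + by have [] := h k.
- exact: latent_prob_var.
- exact: mlatent_var.
Qed.

End latent_existence.

Theorem theorem3p20 (R : realType) (N p M : nat) (V : R -> \bar R)
    (hN : (0 < N)%N) (hp : (0 < p)%N) (hM : ((N - 1) * p + 1 <= M)%N)
    (mV : measurable_fun (`[0%R, +oo[%classic : set R) V)
    (V_gtNy : forall t : R, 0 <= t -> (-oo < V t)%E)
    (wd : beta_well_defined N (2 * p)%:R V)
    (d : measure_display) (T : measurableType d) (P : probability T R)
    (lambda : {RV P >-> N.-tuple R[i]})
    (lambda_law : forall A : set (N.-tuple R[i]), measurable A ->
       distribution P lambda A = beta_ensemble (2 * p)%:R V A) :
  (exists (d' : measure_display) (T' : measurableType d')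
     (P' : probability T' R) (I : T' -> {ffun 'I_N -> int})
     (X theta : 'I_N -> {RV P' >-> R}), latent_sample p V I X theta) /\
  (forall (d' : measure_display) (T' : measurableType d')
     (P' : probability T' R) (I : T' -> {ffun 'I_N -> int})
     (X theta : 'I_N -> {RV P' >-> R}), latent_sample p V I X theta ->
     unordered_eq_law
       P (fun w => [tuple tnth (lambda w) k ^+ M | k < N])
       P' (latent_points X theta M)).
Proof.
split.
  exists _, _, (latent_prob hM mV wd), (latent_var hM).
  by exists (latent_radius hM mV wd), (latent_angle hM mV wd); exact: latent_sample_exists.
move=> d' T' P' I X theta sample B mB.
(* The two laws already agree on measurable sets of ordered tuples; [B] enters only through this
   preimage. *)
pose A := @unordered R N @^-1` B.
have mpow : measurable_fun setT
    (fun z : N.-tuple R[i] => [tuple tnth z i ^+ M | i < N]).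
  apply: (measurable_mktuple (f := fun _ (x : R[i]) => x ^+ M)) => i.
  exact: measurable_complexX.
have mS : measurable [set z : N.-tuple R[i] | A [tuple tnth z i ^+ M | i < N]].
  by rewrite -[X in measurable X]setTI; exact: mpow.
transitivity (beta_ensemble (2 * p)%:R V
    [set z : N.-tuple R[i] | A [tuple tnth z i ^+ M | i < N]]).
  by rewrite -lambda_law.
by rewrite (beta_ensemble_power hM mV wd mB) -(latent_points_law hM mV wd sample mB).
Qed.
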